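(* Let $\mathcal{A}\in Sp(2d,\mathbb{R})$ be covariant, i.e. with $d\times d$ block decomposition $$\mathcal{A}=\begin{pmatrix}A_{11}&I-A_{11}&A_{13}&A_{13}\\ A_{21}&-A_{21}&I-A_{11}^T&-A_{11}^T\\ 0&0&I&I\\ -I&I&0&0\end{pmatrix},\quad A_{13}=A_{13}^T,\ A_{21}=A_{21}^T.$$ Then $$\mathcal{A}=V_C^T\mathcal{A}_{FT2}\mathcal{D}_L,\qquad C=\begin{pmatrix}A_{13}&0\\ 0&-A_{21}\end{pmatrix},\quad L=\begin{pmatrix}I&I-A_{11}\\ I&-A_{11}\end{pmatrix}.$$ As a consequence, up to a phase factor, for all $f,g\in\mathcal{S}(\mathbb{R}^d)$, $$W_{\mathcal{A}}(f,g)(x,\xi)=\int_{\mathbb{R}^d}\big[\mathcal{F}(\Phi_{-A_{13}})*(f\otimes\bar g)(L(\cdot,\eta))\big](x)\,\Phi_{A_{21}}(\eta)\,e^{-2\pi i\xi\cdot\eta}\,d\eta.$$ In particular, if $A_{13}=0$, then $$W_{\mathcal{A}}(f,g)(x,\xi)=\int_{\mathbb{R}^d}f(x+(I-A_{11})\eta)\,\overline{g(x-A_{11}\eta)}\,\Phi_{A_{21}}(\eta)\,e^{-2\pi i\xi\cdot\eta}\,d\eta.$$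
   Context: $Sp(2d,\mathbb{R})$ is the group of $4d\times4d$ real symplectic matrices. For $C\in\mathbb{R}^{2d\times2d}$ symmetric, $V_C=\begin{pmatrix}I_{2d}&0\\ C&I_{2d}\end{pmatrix}$; for $L\in GL(2d,\mathbb{R})$, $\mathcal{D}_L=\begin{pmatrix}L^{-1}&0\\ 0&L^T\end{pmatrix}$; $\mathcal{A}_{FT2}=\begin{pmatrix}I&0&0&0\\ 0&0&0&I\\ 0&0&I&0\\ 0&-I&0&0\end{pmatrix}$ ($d\times d$ blocks). Chirps: $\Phi_C(t)=e^{i\pi Ct\cdot t}$ for symmetric $C$. $\mathcal{F}f(\xi)=\int f(t)e^{-2\pi i\xi\cdot t}dt$; the convolution with $\mathcal{F}(\Phi_{-A_{13}})$ is in the variable $x\in\mathbb{R}^d$. For $\mathcal{A}\in Sp(2d,\mathbb{R})$, $W_{\mathcal{A}}(f,g)=\mu(\mathcal{A})(f\otimes\bar g)$, $(f\otimes\bar g)(x,y)=f(x)\overline{g(y)}$, where $\mu(\mathcal{A})$ is the metaplectic operator, a unitary operator on $L^2(\mathbb{R}^{2d})$ determined up to a phase factor (unimodular constant) and multiplicative up to phase, with (up to phase) $\mu\begin{pmatrix}0&I_{2d}\\ -I_{2d}&0\end{pmatrix}=\mathcal{F}$, $\mu(V_C)F(t)=\Phi_C(t)F(t)$, $\mu(\mathcal{D}_L)F(t)=|\det L|^{1/2}F(Lt)$, $\mu(\mathcal{A}_{FT2})=\mathcal{F}_2$, $\mathcal{F}_2F(x,\xi)=\int_{\mathbb{R}^d}F(x,y)e^{-2\pi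 i\xi\cdot y}dy$. *)

(* Defs.v *)
From HB Require Import structures.
From mathcomp Require Import all_boot all_order all_algebra.
From mathcomp Require Import complex.
From mathcomp Require Import all_classical all_reals all_analysis.
Set Implicit Arguments.
Unset Strict Implicit.
Unset Printing Implicit Defensive.
Import Order.TTheory GRing.Theory Num.Theory.
Import numFieldNormedType.Exports.
Local Open Scope classical_set_scope.
Local Open Scope ring_scope.

Definition cV_display : measure_display. Proof. by constructor. Qed.

(* R^n is 'cV[R]_n with the sigma-algebra generated by the coordinates. *)
Section cV_measurable.
Context (R : realType) (n : nat).

Definition cV_coord (i : 'I_n) (x : 'cV[R]_n) : measurableTypeR R := x i 0.

HB.instance Definition _ := @isMeasurable.Build cV_display 'cV[R]_n
  (g_sigma_preimage cV_coord)
  (@sigma_algebra0 _ _ _) (@sigma_algebraC _ _) (@sigma_algebra_bigcup _ _ _).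

Lemma measurable_cV_coord i : measurable_fun [set: 'cV[R]_n] (cV_coord i).
Proof.
move=> _ Y mY; rewrite setTI; apply: sub_sigma_algebra => /=.
rewrite -bigcup_seq/=; exists i => /=; first by rewrite mem_index_enum.
by exists Y => //; rewrite setTI.
Qed.

Lemma measurable_fun_cVP d (T : measurableType d) (f : T -> 'cV[R]_n) :
  (forall i, measurable_fun [set: T] (cV_coord i \o f)) ->
  measurable_fun [set: T] f.
Proof.
move=> mf _ Y mY; rewrite setTI.
suff : g_sigma_preimage (fun i => cV_coord i \o f) `<=` measurable.
  by apply; rewrite g_sigma_preimage_comp; exists Y => //; rewrite setTI.
apply: smallest_sub; first exact: sigma_algebra_measurable.
rewrite -bigcup_seq/= => A [i _ [B mB <-]].
exact: mf.
Qed.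
End cV_measurable.

Section lebesgue_cV.
Context (R : realType).

Definition cons_cV n (p : measurableTypeR R * 'cV[R]_n) : 'cV[R]_n.+1 :=
  col_mx (const_mx p.1 : 'cV[R]_1) p.2.

Lemma measurable_cons_cV n : measurable_fun [set: _] (@cons_cV n).
Proof.
apply: measurable_fun_cVP => i.
have [j ij|j ij] := split_ordP (i : 'I_(1 + n)).
  rewrite (_ : _ \o _ = fst)//; apply/funext => p /=.
  by rewrite /cV_coord /cons_cV ij (@col_mxEu _ 1) mxE.
rewrite (_ : _ \o _ = cV_coord j \o snd).
  by apply: measurableT_comp => //; exact: measurable_cV_coord.
apply/funext => p /=.
by rewrite /cV_coord /cons_cV ij (@col_mxEd _ 1).
Qed.

Definition uncons_cV n (x : 'cV[R]_n.+1) : measurableTypeR R * 'cV[R]_n :=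
  (x 0 0, dsubmx (x : 'cV[R]_(1 + n))).

Lemma cons_cVK n : cancel (@cons_cV n) (@uncons_cV n).
Proof.
move=> [a x]; rewrite /cons_cV /uncons_cV (@col_mxKd _ 1); congr pair.
have -> : (0 : 'I_n.+1) = lshift n (0 : 'I_1) by exact/val_inj.
by rewrite (@col_mxEu _ 1) mxE.
Qed.

Lemma measurable_uncons_cV n : measurable_fun [set: _] (@uncons_cV n).
Proof.
apply: measurable_fun_pair; first exact: measurable_cV_coord.
apply: measurable_fun_cVP => i.
rewrite (_ : _ \o _ = cV_coord (rshift 1 i : 'I_n.+1)).
  exact: measurable_cV_coord.
by apply/funext => x /=; rewrite /cV_coord mxE.
Qed.

Section leb_succ.
Context (n : nat) (m : {sigma_finite_measure set 'cV[R]_n -> \bar R}).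
Local Open Scope ereal_scope.

Definition leb_succ : set 'cV[R]_n.+1 -> \bar R :=
  pushforward (lebesgue_measure \x m) (@cons_cV n).

Let leb_succ0 : leb_succ set0 = 0.
Proof. by rewrite /leb_succ /pushforward preimage_set0 measure0. Qed.

Let leb_succ_ge0 A : 0 <= leb_succ A.
Proof. by rewrite /leb_succ /pushforward; apply: measure_ge0. Qed.

Let measurable_preimage_cons A :
  measurable A -> measurable (@cons_cV n @^-1` A).
Proof. by move=> mA; rewrite -[X in measurable X]setTI; exact: measurable_cons_cV. Qed.

Let leb_succ_sigma_additive : semi_sigma_additive leb_succ.
Proof.
move=> F mF tF mUF; rewrite /leb_succ /pushforward preimage_bigcup.
apply: measure_semi_sigma_additive.
- by move=> k; exact: measurable_preimage_cons.
- apply/trivIsetP => /= i j _ _ ij; rewrite -preimage_setI.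
  by move/trivIsetP : tF => /(_ _ _ _ _ ij) ->//; rewrite preimage_set0.
- by rewrite -preimage_bigcup; exact: measurable_preimage_cons.
Qed.

HB.instance Definition _ := isMeasure.Build _ _ _ leb_succ
  leb_succ0 leb_succ_ge0 leb_succ_sigma_additive.

Let leb_succ_sigma_finite : sigma_finite setT leb_succ.
Proof.
have /sigma_finiteP[F [TF ndF Foo]] :=
  sigma_finiteT (@lebesgue_measure R : {sigma_finite_measure set _ -> \bar R}).
have /sigma_finiteP[G [TG ndG Goo]] := sigma_finiteT m.
exists (fun k => @uncons_cV n @^-1` (F k `*` G k)).
  rewrite -preimage_bigcup predeqE => x; split => // _.
  have [i _ Fi] : (\bigcup_i F i) (uncons_cV x).1 by rewrite -TF.
  have [j _ Gj] : (\bigcup_i G i) (uncons_cV x).2 by rewrite -TG.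
  exists (maxn i j) => //; split.
  - by move: Fi; exact/subsetPset/ndF/leq_maxl.
  - by move: Gj; exact/subsetPset/ndG/leq_maxr.
move=> k; have [mF Fk] := Foo k; have [mG Gk] := Goo k.
have mFG : measurable (F k `*` G k) by exact: measurableX.
split; first by rewrite -[X in measurable X]setTI; exact: measurable_uncons_cV.
rewrite /leb_succ /pushforward -comp_preimage.
rewrite (_ : _ \o _ = id); last by apply/funext; exact: cons_cVK.
by rewrite preimage_id product_measure1E// lte_mul_pinfty// ge0_fin_numE.
Qed.

HB.instance Definition _ := Measure_isSigmaFinite.Build _ _ _ leb_succ
  leb_succ_sigma_finite.

End leb_succ.

Fixpoint leb n : {sigma_finite_measure set 'cV[R]_n -> \bar R} :=
  if n is k.+1 then leb_succ (leb k) else \d_(0 : 'cV[R]_0).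

End lebesgue_cV.
Arguments leb {R} n.

Section functions.
Context (R : realType).
Implicit Types n d : nat.

Definition dot n (x y : 'cV[R]_n) : R := (x^T *m y) 0 0.

(* e^{i t} *)
Definition expi (t : R) : R[i] := (cos t +i* sin t)%C.

Definition cint n (F : 'cV[R]_n -> R[i]) : R[i] :=
  (Rintegral (leb n) setT (fun x => complex.Re (F x))
   +i* Rintegral (leb n) setT (fun x => complex.Im (F x)))%C.

Definition in_L1 n (F : 'cV[R]_n -> R[i]) : Prop :=
  (leb n).-integrable setT (fun x => (complex.Re (F x))%:E) /\
  (leb n).-integrable setT (fun x => (complex.Im (F x))%:E).

Definition in_L2 n (F : 'cV[R]_n -> R[i]) : Prop :=
  [/\ measurable_fun setT (fun x => complex.Re (F x) : measurableTypeR R),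
      measurable_fun setT (fun x => complex.Im (F x) : measurableTypeR R) &
      (\int[leb n]_x (complex.Re (F x) ^+ 2 + complex.Im (F x) ^+ 2)%:E
        < +oo)%E].

Definition inner n (F G : 'cV[R]_n -> R[i]) : R[i] :=
  cint (fun x => F x * (G x)^*%C).

Definition fourier n (F : 'cV[R]_n -> R[i]) (xi : 'cV[R]_n) : R[i] :=
  cint (fun t => F t * expi (- (2 * pi * dot xi t))).

(* A point (x, xi) of R^d x R^d is the column vector col_mx x xi. *)
Definition fourier2 d (F : 'cV[R]_(d + d) -> R[i]) (z : 'cV[R]_(d + d)) :
    R[i] :=
  cint (fun y : 'cV[R]_d =>
    F (col_mx (usubmx z) y) * expi (- (2 * pi * dot (dsubmx z) y))).

Definition chirp n (C : 'M[R]_n) (t : 'cV[R]_n) : R[i] :=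
  expi (pi * dot (C *m t) t).

Definition tensor d (f g : 'cV[R]_d -> R[i]) (z : 'cV[R]_(d + d)) : R[i] :=
  f (usubmx z) * (g (dsubmx z))^*%C.

(* The Schwartz class. Both the monomials x^alpha and the partial derivatives
   D^beta are indexed by lists of coordinates, repetitions allowed. *)
Definition partial n (i : 'I_n) (u : 'cV[R]_n -> R) : 'cV[R]_n -> R :=
  fun x => 'D_(delta_mx i 0) u x.

Definition partials n (beta : seq 'I_n) (u : 'cV[R]_n -> R) : 'cV[R]_n -> R :=
  foldr (@partial n) u beta.

Definition rschwartz n (u : 'cV[R]_n -> R) : Prop :=
  (forall beta x, differentiable (partials beta u) x) /\
  (forall alpha beta : seq 'I_n, exists M : R, forall x : 'cV[R]_n,
    `|(\prod_(i <- alpha) x i 0) * partials beta u x| <= M).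

Definition schwartz n (f : 'cV[R]_n -> R[i]) : Prop :=
  rschwartz (fun x => complex.Re (f x)) /\
  rschwartz (fun x => complex.Im (f x)).

(* Tempered distributions are represented by functionals on complex functions;
   only their values on Schwartz functions are meaningful. *)
Definition distrib n := ('cV[R]_n -> R[i]) -> R[i].

Definition dist_of n (phi : 'cV[R]_n -> R[i]) : distrib n :=
  fun h => cint (fun t => phi t * h t).

Definition dist_fourier n (T : distrib n) : distrib n :=
  fun h => T (fourier h).

(* (T * h)(x) = < T, h(x - .) > *)
Definition dist_conv n (T : distrib n) (h : 'cV[R]_n -> R[i]) :
    'cV[R]_n -> R[i] :=
  fun x => T (fun y => h (x - y)).

Definition symp_J n : 'M[R]_(n + n) := block_mx 0 1%:M (- 1%:M) 0.

Definition symplectic n (A : 'M[R]_(n + n)) : Prop :=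
  A^T *m symp_J n *m A = symp_J n.

Definition symp_V n (C : 'M[R]_n) : 'M[R]_(n + n) := block_mx 1%:M 0 C 1%:M.

Definition symp_D n (L : 'M[R]_n) : 'M[R]_(n + n) :=
  block_mx (invmx L) 0 0 L^T.

Definition symp_FT2 d : 'M[R]_((d + d) + (d + d)) :=
  block_mx (block_mx 1%:M 0 0 0) (block_mx 0 0 0 1%:M)
           (block_mx 0 0 0 (- 1%:M)) (block_mx 1%:M 0 0 0).

Definition covariant_mx d (A11 A13 A21 : 'M[R]_d) :
    'M[R]_((d + d) + (d + d)) :=
  block_mx
    (block_mx A11 (1%:M - A11) A21 (- A21))
    (block_mx A13 A13 (1%:M - A11^T) (- A11^T))
    (block_mx 0 0 (- 1%:M) 1%:M)
    (block_mx 1%:M 1%:M 0 0).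

(* Operators on L^2(R^n), acting on representatives: two functions in L^2 are
   identified when they agree almost everywhere, and the values of an operator
   outside L^2 are irrelevant. *)
Definition operator n := ('cV[R]_n -> R[i]) -> ('cV[R]_n -> R[i]).

Record unitary_L2 n (U : operator n) : Prop := UnitaryL2 {
  unitary_in_L2 : forall F, in_L2 F -> in_L2 (U F) ;
  unitary_ae : forall F G, in_L2 F -> in_L2 G ->
    {ae leb n, forall t, F t = G t} -> {ae leb n, forall t, U F t = U G t} ;
  unitary_linear : forall (a : R[i]) F G, in_L2 F -> in_L2 G ->
    {ae leb n, forall t, U (fun s => a * F s + G s) t = a * U F t + U G t} ;
  unitary_inner : forall F G, in_L2 F -> in_L2 G ->
    inner (U F) (U G) = inner F G ;
  unitary_surj : forall G, in_L2 G ->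
    exists2 F, in_L2 F & {ae leb n, forall t, U F t = G t} }.

(* U = V up to a unimodular constant, on the functions satisfying dom. *)
Definition eq_phase_on n (dom : ('cV[R]_n -> R[i]) -> Prop)
    (U V : operator n) : Prop :=
  exists2 c : R[i], `|c| = 1 &
    forall F, dom F -> {ae leb n, forall t, U F t = c * V F t}.

(* The Fourier transform of L^2, total or partial, is the continuous extension
   of the integral formula from the dense subspace of functions that are both
   in L^1 and in L^2; a unitary operator is equal to it (up to a phase) as soon
   as it is on this subspace. As the matrices symp_J, symp_V C and symp_D L
   generate the symplectic group, these properties determine each mu A up to a
   phase. *)
Record metaplectic d (mu : 'M[R]_((d + d) + (d + d)) -> operator (d + d)) :
    Prop := Metaplectic {
  metaplectic_unitary : forall A, symplectic A -> unitary_L2 (mu A) ;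
  metaplectic_mul : forall A B, symplectic A -> symplectic B ->
    eq_phase_on (@in_L2 _) (mu (A *m B)) (mu A \o mu B) ;
  metaplectic_J :
    eq_phase_on (fun F => in_L1 F /\ in_L2 F)
      (mu (symp_J (d + d))) (@fourier _) ;
  metaplectic_V : forall C, C^T = C ->
    eq_phase_on (@in_L2 _) (mu (symp_V C)) (fun F t => chirp C t * F t) ;
  metaplectic_D : forall L, L \in unitmx ->
    eq_phase_on (@in_L2 _) (mu (symp_D L))
      (fun F t => (Num.sqrt `|\det L|)%:C%C * F (L *m t)) ;
  metaplectic_FT2 :
    eq_phase_on (fun F => in_L1 F /\ in_L2 F)
      (mu (symp_FT2 d)) (@fourier2 d) }.

Definition wigner d (mu : 'M[R]_((d + d) + (d + d)) -> operator (d + d))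
    (A : 'M[R]_((d + d) + (d + d))) (f g : 'cV[R]_d -> R[i]) :
    'cV[R]_(d + d) -> R[i] :=
  mu A (tensor f g).

End functions.

(* Main.v *)
(* The covariant matrix also factors as J V_{-C} D_P A_FT2 D_M, where P swaps the
two blocks and M (eta, y) = L (-y, eta).  Indeed V_C^T = J V_{-C} J^{-1}, and
J^{-1} A_FT2 stands for the inverse partial Fourier transform in the first
variable, which is F_2 up to permutations and reflections.  Hence mu(A)(f (x) g)
is, up to a phase, the Fourier transform of Phi_{-C} H, where H(u, eta) is the
inverse Fourier transform of y |-> (f (x) g)(L (y, eta)) at u; H decays rapidly
in both variables because f and g are Schwartz functions, so that Fubini gives
the iterated integral.

When A_13 = 0 Fourier inversion is needed, with the exact constant.  It comes from
the metaplectic representation itself: A_FT2^2 = D_{diag(I, -I)} gives inversion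
up to a phase, and the phase is 1 since its product with |K|^2 is
|F K|^2 >= 0. *)
Require Import Defs.
From HB Require Import structures.
From mathcomp Require Import all_boot all_order all_algebra.
From mathcomp Require Import complex.
From mathcomp Require Import all_classical all_reals all_analysis.
From mathcomp Require Import measurable_realfun ring lra.
Set Implicit Arguments.
Unset Strict Implicit.
Unset Printing Implicit Defensive.
Import Order.TTheory GRing.Theory Num.Theory.
Import numFieldNormedType.Exports.
Local Open Scope classical_set_scope.
Local Open Scope ring_scope.

(** * Integration on R^n *)

(** [metaplectic] describes [mu] on generators only, and for [symp_J] and [symp_FT2] only on
    functions lying in both L^1 and L^2. The factor V_C^T is not one of these generators and would
    act as convolution with a distribution. Along the other factorization, every function met when
    starting from a Schwartz tensor is dominated by a multiple of one integrable product, [rho], so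
    that each formula is an absolutely convergent integral. The delicate majorant is that of the
    partial Fourier transform, which must hold in u and eta jointly: it takes y-derivatives of the
    kernel up to order 2d, controlled uniformly in eta, hence a class of kernels closed under
    differentiation in y ([sprod]). Inversion drawn from [mu] holds for almost every (eta, x) only;
    Tonelli turns this into almost every eta for almost every x, which is all that the outer
    integral sees. *)

Lemma uncons_cVK (R : realType) n : cancel (@uncons_cV R n) (@cons_cV R n).
Proof.
move=> x; rewrite /cons_cV /uncons_cV/= -[RHS](@vsubmxK _ 1).
congr (@col_mx _ 1); apply/colP => i; rewrite !mxE; congr (x _ _).
by apply/val_inj; rewrite /= ord1.
Qed.

Section leb_integrals.
Context (R : realType).
Local Open Scope ereal_scope.

Lemma ge0_integral_leb0 (f : 'cV[R]_0 -> \bar R) :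
  measurable_fun [set: 'cV[R]_0] f -> \int[leb 0]_x f x = f 0%R.
Proof.
move=> mf; rewrite /= integral_dirac//.
by rewrite diracT mul1e.
Qed.

Lemma ge0_integral_lebS n (f : 'cV[R]_n.+1 -> \bar R) :
  measurable_fun [set: 'cV[R]_n.+1] f -> (forall x, 0 <= f x) ->
  \int[leb n.+1]_x f x =
  \int[lebesgue_measure]_a \int[leb n]_x f (cons_cV (a, x)).
Proof.
move=> mf f0.
have mc := @measurable_cons_cV R n.
rewrite [LHS](_ : _ = \int[pushforward (lebesgue_measure \x leb n) (@cons_cV R n)]_x f x)//.
rewrite ge0_integral_pushforward// preimage_setT.
rewrite fubini_tonelli1//; last by move=> x; exact: f0.
exact: (measurableT_comp mf mc).
Qed.

Lemma measurable_affine_cV n (a : R) (b : 'cV[R]_n) :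
  measurable_fun [set: 'cV[R]_n] (fun x => a *: x + b)%R.
Proof.
apply: measurable_fun_cVP => i.
rewrite (_ : _ \o _ = fun x => a * cV_coord i x + b i 0)%R; last first.
  by apply/funext => x; rewrite /cV_coord/= !mxE.
apply: measurable_funD => //; apply: measurable_funM => //.
exact: measurable_cV_coord.
Qed.

(** The image of Lebesgue measure under [phi] agrees with it on half-open intervals, and these
    determine the measure. The values 1 and -1 of [a] cover translations and reflections, with no
    Jacobian factor. *)
Lemma ge0_integral_lebesgue_affine (a b : R) (f : measurableTypeR R -> \bar R) :
  a = 1%R \/ a = (-1)%R ->
  measurable_fun [set: measurableTypeR R] f -> (forall x, 0 <= f x) ->
  \int[lebesgue_measure]_x f (a * x + b)%R = \int[lebesgue_measure]_x f x.
Proof.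
move=> a1 mf f0.
pose phi : measurableTypeR R -> measurableTypeR R := fun x => (a * x + b)%R.
have mphi : measurable_fun [set: measurableTypeR R] phi.
  by apply: measurable_funD => //; exact: measurable_funM.
transitivity (\int[pushforward lebesgue_measure phi]_x f x); last first.
  apply: eq_measure_integral => A mA _; apply/esym.
  apply: lebesgue_measure_unique mA => _ [[c e]] _ <-.
  transitivity (lebesgue_measure (phi @^-1` `]c, e]%classic)) => //.
  have [a_eq|a_eq] := a1.
  - rewrite (_ : phi @^-1` _ = `](c - b)%R, (e - b)%R]%classic); last first.
      apply/seteqP; split=> x /=; rewrite !in_itv/= /phi a_eq mul1r; lra.
    rewrite !lebesgue_measure_itv/= !lte_fin ltrD2r; case: ifP => // _.
    by rewrite -!EFinB; congr EFin; ring.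
  (* A reflection opens the interval at its other end; the length is the same. *)
  - rewrite (_ : phi @^-1` _ = `[(b - e)%R, (b - c)%R[%classic); last first.
      apply/seteqP; split=> x /=; rewrite !in_itv/= /phi a_eq mulN1r; lra.
    rewrite !lebesgue_measure_itv/= !lte_fin ltrD2l ltrN2; case: ifP => // _.
    by rewrite -!EFinB; congr EFin; ring.
by rewrite ge0_integral_pushforward// preimage_setT.
Qed.

Lemma cons_cV_affine n (a b0 t : R) (b x : 'cV[R]_n) :
  (a *: cons_cV (t, x) + cons_cV (b0, b))%R =
  cons_cV ((a * t + b0)%R : measurableTypeR R, a *: x + b)%R.
Proof.
rewrite /cons_cV/= (@scale_col_mx _ 1) (@add_col_mx _ 1).
by congr (@col_mx _ 1); apply/colP => i; rewrite !mxE.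
Qed.

Lemma ge0_integral_leb_affine n (a : R) (b : 'cV[R]_n) (f : 'cV[R]_n -> \bar R) :
  a = 1%R \/ a = (-1)%R ->
  measurable_fun [set: 'cV[R]_n] f -> (forall x, 0 <= f x) ->
  \int[leb n]_x f (a *: x + b)%R = \int[leb n]_x f x.
Proof.
move=> a1; elim: n => [|n ih] in b f *; move=> mf f0.
  by apply: eq_integral => x _; congr f; rewrite [LHS]flatmx0 [RHS]flatmx0.
have mfa : measurable_fun [set: 'cV[R]_n.+1] (fun x => f (a *: x + b)%R).
  exact: (measurableT_comp mf (measurable_affine_cV a b)).
rewrite (ge0_integral_lebS mf f0) (ge0_integral_lebS mfa); last by move=> x; exact: f0.
have mfc (g : 'cV[R]_n.+1 -> \bar R) : measurable_fun [set: 'cV[R]_n.+1] g ->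
    measurable_fun setT (g \o @cons_cV R n).
  by move=> mg; apply: (measurableT_comp mg (@measurable_cons_cV R n)).
have mfb t : measurable_fun [set: 'cV[R]_n] (fun x => f (cons_cV (t, x))).
  exact: (measurableT_comp (mfc _ mf) (measurable_pair1 t)).
rewrite -[b]uncons_cVK; case: (uncons_cV b) => b0 b'.
under eq_integral => t _.
  under eq_integral do rewrite cons_cV_affine.
  rewrite (ih b' (fun x => f (cons_cV ((a * t + b0)%R, x))))//.
  over.
rewrite (ge0_integral_lebesgue_affine b0 (f := fun t => \int[leb n]_x f (cons_cV (t, x))))//.
  apply: (measurable_fun_fubini_tonelli_F (m2 := leb n) (f \o @cons_cV R n) (mfc _ mf)).
  by move=> x; exact: f0.
by move=> t; exact: integral_ge0.
Qed.

Lemma integral_leb_affine n (a : R) (b : 'cV[R]_n) (f : 'cV[R]_n -> \bar R) :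
  a = 1%R \/ a = (-1)%R -> measurable_fun [set: 'cV[R]_n] f ->
  \int[leb n]_x f (a *: x + b)%R = \int[leb n]_x f x.
Proof.
move=> a1 mf; rewrite [LHS]integralE [RHS]integralE; congr (_ - _).
- transitivity (\int[leb n]_x f^\+ (a *: x + b)%R).
    apply: eq_integral => x _.
    by rewrite -[RHS]/((f^\+ \o (fun x => a *: x + b)%R) x) -funepos_comp.
  apply: (ge0_integral_leb_affine b a1); first exact: measurable_funepos.
  by move=> x; exact: funepos_ge0.
- transitivity (\int[leb n]_x f^\- (a *: x + b)%R).
    apply: eq_integral => x _.
    by rewrite -[RHS]/((f^\- \o (fun x => a *: x + b)%R) x) -funeneg_comp.
  apply: (ge0_integral_leb_affine b a1); first exact: measurable_funeneg.
  by move=> x; exact: funeneg_ge0.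
Qed.

Definition col_cV m n (p : 'cV[R]_m * 'cV[R]_n) : 'cV[R]_(m + n) := col_mx p.1 p.2.

Lemma measurable_col_cV m n :
  measurable_fun [set: 'cV[R]_m * 'cV[R]_n] (@col_cV m n).
Proof.
apply: measurable_fun_cVP => i.
have [j ij|j ij] := split_ordP i.
- rewrite (_ : _ \o _ = cV_coord j \o fst).
    exact: (measurableT_comp (measurable_cV_coord j) measurable_fst).
  by apply/funext => p /=; rewrite /cV_coord /col_cV ij col_mxEu.
- rewrite (_ : _ \o _ = cV_coord j \o snd).
    exact: (measurableT_comp (measurable_cV_coord j) measurable_snd).
  by apply/funext => p /=; rewrite /cV_coord /col_cV ij col_mxEd.
Qed.

(** [(m + n).+1] and [m.+1 + n] are convertible, so that only positions of entries have to be
    compared. This lets the splitting of integrals go by induction on [m]. *)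
Lemma cons_cV_col m n (a : R) (x : 'cV[R]_m) (y : 'cV[R]_n) :
  cons_cV (a, col_mx x y) = col_mx (cons_cV (a, x)) y :> 'cV[R]_(m.+1 + n).
Proof.
apply/colP => i; rewrite /cons_cV/= [LHS]mxE [RHS]mxE.
case: splitP => [j ij|k ik]; case: splitP => [l il|l il].
- rewrite [LHS]mxE [RHS]mxE; case: splitP => [k lk|k lk]; first by rewrite mxE.
  by move: (ltn_ord j); rewrite -ij il lk.
- by move: (ltn_ord j); rewrite -ij il.
- rewrite [LHS]mxE [RHS]mxE; case: splitP => [u ku|u ku]; case: splitP => [v lv|v lv].
  + by move: (ltn_ord v); rewrite -lv -il ik.
  + congr (x _ _); apply/val_inj => /=.
    by apply/eqP; rewrite -ku -(eqn_add2l 1) -ik il lv.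
  + by move: (ltn_ord v); rewrite -lv -il ik.
  + by move: (ltn_ord l); rewrite -il ik ku add1n ltnS -[X in (_ < X)%N]addn0 ltn_add2l.
- rewrite [LHS]mxE; case: splitP => [u ku|u ku].
  + by move: (ltn_ord u); rewrite -ku -(ltn_add2l 1) -ik il add1n -[X in (_ < X)%N]addn0 ltn_add2l.
  + congr (y _ _); apply/val_inj => /=.
    by apply/eqP; rewrite -(eqn_add2l m.+1) -il ik ku addnA.
Qed.

Lemma col_cV0 n (y : 'cV[R]_n) : col_mx (0%R : 'cV[R]_0) y = y.
Proof.
apply/colP => i; rewrite mxE; case: splitP => [[]//|k ik].
by congr (y _ _); apply/val_inj.
Qed.

Lemma measurable_col_cVl m n (x : 'cV[R]_m) :
  measurable_fun [set: 'cV[R]_n] (col_mx x).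
Proof. exact: (measurableT_comp (@measurable_col_cV m n) (measurable_pair1 x)). Qed.

Lemma measurable_col_cVr m n (y : 'cV[R]_n) :
  measurable_fun [set: 'cV[R]_m] (fun x => col_mx x y).
Proof. exact: (measurableT_comp (@measurable_col_cV m n) (measurable_pair2 y)). Qed.

Lemma measurable_usubmx m n :
  measurable_fun [set: 'cV[R]_(m + n)] (usubmx : _ -> 'cV[R]_m).
Proof.
apply: measurable_fun_cVP => i.
rewrite (_ : _ \o _ = cV_coord (lshift n i)); first exact: measurable_cV_coord.
by apply/funext => x; rewrite /cV_coord/= mxE.
Qed.

Lemma measurable_dsubmx m n :
  measurable_fun [set: 'cV[R]_(m + n)] (dsubmx : _ -> 'cV[R]_n).
Proof.
apply: measurable_fun_cVP => i.
rewrite (_ : _ \o _ = cV_coord (rshift m i)); first exact: measurable_cV_coord.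
by apply/funext => x; rewrite /cV_coord/= mxE.
Qed.

Lemma measurable_mulmx m n (A : 'M[R]_(n, m)) :
  measurable_fun [set: 'cV[R]_m] (fun x : 'cV[R]_m => (A *m x)%R).
Proof.
apply: measurable_fun_cVP => i.
rewrite (_ : _ \o _ = fun x => (\sum_(j < m) A i j * cV_coord j x)%R); last first.
  by apply/funext => x; rewrite /cV_coord/= mxE.
apply: (measurable_sum _ (h := fun j x => (A i j * cV_coord j x)%R)) => j.
by apply: measurable_funM => //; exact: measurable_cV_coord.
Qed.

Lemma ge0_measurable_integral_col m n (f : 'cV[R]_(m + n) -> \bar R) :
  measurable_fun [set: 'cV[R]_(m + n)] f -> (forall x, 0 <= f x) ->
  measurable_fun [set: 'cV[R]_m] (fun x => \int[leb n]_y f (col_mx x y)).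
Proof.
move=> mf f0.
apply: (measurable_fun_fubini_tonelli_F (m2 := leb n) (f \o @col_cV m n)
  (measurableT_comp mf (@measurable_col_cV m n))).
by move=> x; exact: f0.
Qed.

Lemma ge0_integral_leb_col m n (f : 'cV[R]_(m + n) -> \bar R) :
  measurable_fun [set: 'cV[R]_(m + n)] f -> (forall x, 0 <= f x) ->
  \int[leb (m + n)]_z f z = \int[leb m]_x \int[leb n]_y f (col_mx x y).
Proof.
elim: m => [|m ih] in f * => mf f0.
  rewrite ge0_integral_leb0; last exact: ge0_measurable_integral_col.
  by apply: eq_integral => y _; rewrite col_cV0.
rewrite [LHS](ge0_integral_lebS (n := m + n) mf f0).
rewrite [RHS]ge0_integral_lebS; last 2 first.
- exact: ge0_measurable_integral_col.
- by move=> x; exact: integral_ge0.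
apply: eq_integral => a _.
rewrite (ih (fun w => f (cons_cV (a, w)))); first last.
- by move=> w; exact: f0.
- exact: (measurableT_comp (measurableT_comp mf (@measurable_cons_cV R (m + n)))
    (measurable_pair1 a)).
apply: eq_integral => x _; apply: eq_integral => y _.
by rewrite cons_cV_col.
Qed.

End leb_integrals.

(** * Fubini and null sets on R^(m + n) *)

Section leb_integrable.
Context (R : realType).
Local Open Scope ereal_scope.

Lemma integral_indicT d (T : measurableType d) (mu : {measure set T -> \bar R})
  (A : set T) : measurable A -> \int[mu]_x (\1_A x)%:E = mu A.
Proof. by move=> mA; rewrite integral_indic// setIT. Qed.

Lemma integral_leb_col_prod m n (f : 'cV[R]_(m + n) -> \bar R) :
  measurable_fun [set: 'cV[R]_(m + n)] f ->
  \int[leb (m + n)]_z f z = \int[leb m \x leb n]_p f (col_cV p).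
Proof.
have H (g : 'cV[R]_(m + n) -> \bar R) :
    measurable_fun [set: 'cV[R]_(m + n)] g -> (forall x, 0 <= g x) ->
    \int[leb (m + n)]_z g z = \int[leb m \x leb n]_p g (col_cV p).
  move=> mg g0; rewrite ge0_integral_leb_col//.
  rewrite (fubini_tonelli1 (fun p => g (col_cV p)))//.
  exact: (measurableT_comp mg (@measurable_col_cV R m n)).
move=> mf; rewrite [LHS]integralE [RHS]integralE; congr (_ - _).
- rewrite H; last by move=> x; exact: funepos_ge0.
    by apply: eq_integral => p _; rewrite -[LHS]/((f^\+ \o @col_cV R m n) p) -funepos_comp.
  exact: measurable_funepos.
- rewrite H; last by move=> x; exact: funeneg_ge0.
    by apply: eq_integral => p _; rewrite -[LHS]/((f^\- \o @col_cV R m n) p) -funeneg_comp.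
  exact: measurable_funeneg.
Qed.

Lemma integrable_leb_col_prod m n (f : 'cV[R]_(m + n) -> \bar R) :
  (leb (m + n)).-integrable setT f ->
  (leb m \x leb n).-integrable setT (f \o @col_cV R m n).
Proof.
move=> /integrableP[mf fy].
have mc := @measurable_col_cV R m n.
apply/integrableP; split; first exact: (measurableT_comp mf mc).
by move: fy; rewrite integral_leb_col_prod//; exact: measurableT_comp.
Qed.

Lemma Rintegral_leb_col m n (f : 'cV[R]_(m + n) -> R) :
  (leb (m + n)).-integrable setT (EFin \o f) ->
  Rintegral (leb (m + n)) setT f =
  Rintegral (leb m) setT (fun x => Rintegral (leb n) setT (fun y => f (col_mx x y))).
Proof.
move=> fi; have fpi := integrable_leb_col_prod fi.
rewrite /Rintegral integral_leb_col_prod; last exact: measurable_int fi.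
rewrite -(integral12_prod_meas1 fpi); congr fine.
have Fi := integrable_fubini_F fpi.
apply: ae_eq_integral => //.
- exact: measurable_int Fi.
- apply/measurable_EFinP; apply: (measurableT_comp (fine_measurable measurableT)).
  exact: measurable_int Fi.
(* The inner integral is finite for almost every [x], and there [fine] loses nothing. *)
- apply: filterS (integrable_ae measurableT Fi) => x /(_ Logic.I) xfin _ /=.
  by rewrite fineK.
Qed.

Lemma Rintegral_leb_col_sym m n (f : 'cV[R]_(m + n) -> R) :
  (leb (m + n)).-integrable setT (EFin \o f) ->
  Rintegral (leb (m + n)) setT f =
  Rintegral (leb n) setT (fun y => Rintegral (leb m) setT (fun x => f (col_mx x y))).
Proof.
move=> fi; have fpi := integrable_leb_col_prod fi.
rewrite /Rintegral integral_leb_col_prod; last exact: measurable_int fi.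
rewrite -(integral21_prod_meas1 fpi); congr fine.
have mG := measurable_fubini_G fpi.
apply: ae_eq_integral => //.
- apply/measurable_EFinP.
  exact: (measurableT_comp (fine_measurable measurableT) mG).
- apply: filterS (ae_integrable2 fpi) => y yi _ /=.
  by rewrite fineK//; exact: integrable_fin_num.
Qed.

(** Tonelli on the indicator of a null set [N] that covers the exceptions: the measures of its
    sections have integral 0, so almost all sections are null. *)
Lemma ae_leb_col_sym m n (P : 'cV[R]_(m + n) -> Prop) :
  {ae leb (m + n), forall z, P z} ->
  {ae leb n, forall y, {ae leb m, forall x, P (col_mx x y)}}.
Proof.
move=> [N [mN N0 PN]].
have mi : measurable_fun [set: 'cV[R]_m * 'cV[R]_n]
    (fun p => (\1_N (col_cV p))%:E : \bar R).
  apply: (@measurableT_comp _ _ _ _ _ _ (fun z => (\1_N z)%:E)).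
    by apply/measurable_EFinP; exact: measurable_indic.
  exact: measurable_col_cV.
have i0 p : 0 <= (\1_N (@col_cV R m n p))%:E :> \bar R by rewrite lee_fin.
have mF := measurable_fun_fubini_tonelli_G (m1 := leb m) _ mi i0.
have F0 : (\int[leb n]_y \int[leb m]_x (\1_N (col_mx x y))%:E = 0 :> \bar R)%E.
  rewrite -[LHS](fubini_tonelli2 (m1 := leb m) (m2 := leb n) _ mi i0).
  rewrite -(integral_leb_col_prod (f := fun z => (\1_N z)%:E)) ?integral_indicT//.
  by apply/measurable_EFinP; exact: measurable_indic.
have /(ae_eq_integral_abs _ measurableT mF).1 : (\int[leb n]_y
    `|\int[leb m]_x (\1_N (col_mx x y))%:E| = 0 :> \bar R)%E.
  rewrite -[RHS]F0; apply: eq_integral => x _; rewrite gee0_abs//.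
  exact: integral_ge0.
apply: filterS => y /(_ Logic.I) /= Fy.
have mNy : measurable [set x | N (col_mx x y)].
  rewrite -[X in measurable X]setTI.
  exact: (measurable_col_cVr y measurableT mN).
exists [set x | N (col_mx x y)]; split => //.
- by rewrite -[RHS]Fy -integral_indicT.
- by move=> x /= NP; apply: PN.
Qed.

(** The exceptions lie in a cylinder over a null set [N]. Each of its sections in [x] is [N] itself,
    so Tonelli with the integral in [x] inside gives measure 0. *)
Lemma ae_leb_usub m n (P : 'cV[R]_m -> Prop) :
  {ae leb m, forall x, P x} -> {ae leb (m + n), forall z, P (usubmx z)}.
Proof.
move=> [N [mN N0 PN]].
have mNu : measurable [set z : 'cV[R]_(m + n) | N (usubmx z)].
  by rewrite -[X in measurable X]setTI; exact: measurable_usubmx.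
exists [set z | N (usubmx z)]; split => //; last first.
  by move=> z /= Pz; exact: PN.
rewrite -integral_indicT// integral_leb_col_prod; last first.
  by apply/measurable_EFinP; exact: measurable_indic.
rewrite (fubini_tonelli2 (fun p : 'cV[R]_m * 'cV[R]_n =>
    (\1_[set z : 'cV[R]_(m + n) | N (usubmx z)] (col_cV p))%:E)); last first.
- by move=> p; rewrite lee_fin.
- apply: (@measurableT_comp _ _ _ _ _ _ (fun z => (\1_[set z | N (usubmx z)] z)%:E)) => //.
    by apply/measurable_EFinP; exact: measurable_indic.
  exact: measurable_col_cV.
apply: integral0_eq => y _; rewrite /fubini_G/=.
rewrite -[RHS]N0 -integral_indicT//.
apply: eq_integral => x _; rewrite !indicE/= /col_cV; congr ((nat_of_bool _)%:R%:E).
by apply/idP/idP; rewrite !inE/= col_mxKu.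
Qed.
End leb_integrable.

(** * Borel measurability on R^n and the integrable majorant *)

Section cV_functions.
Context (R : realType).

(** Positive and negative parts have measurable integrals by Tonelli, and [Rintegral] is [fine] of
    their difference whether or not the slices are integrable. *)
Lemma measurable_Rintegral_col m n (f : 'cV[R]_(m + n) -> R) :
  measurable_fun [set: 'cV[R]_(m + n)] (f : _ -> measurableTypeR R) ->
  measurable_fun [set: 'cV[R]_m]
    (fun x => Rintegral (leb n) setT (fun y => f (col_mx x y)) : measurableTypeR R).
Proof.
move=> mf; have mEf : measurable_fun setT (EFin \o f) by exact/measurable_EFinP.
apply: (measurableT_comp (fine_measurable measurableT)).
rewrite (_ : (fun _ => _) = (fun x =>
    \int[leb n]_y ((EFin \o f)^\+)%E (col_mx x y) -
    \int[leb n]_y ((EFin \o f)^\-)%E (col_mx x y))%E); last first.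
  apply/funext => x; rewrite [LHS]integralE; congr (_ - _)%E.
    apply: eq_integral => y _.
    by rewrite -[RHS]/((((EFin \o f)^\+)%E \o col_mx x) y) -funepos_comp.
  apply: eq_integral => y _.
  by rewrite -[RHS]/((((EFin \o f)^\-)%E \o col_mx x) y) -funeneg_comp.
apply: emeasurable_funB; apply: ge0_measurable_integral_col.
- exact: measurable_funepos.
- by move=> x; exact: funepos_ge0.
- exact: measurable_funeneg.
- by move=> x; exact: funeneg_ge0.
Qed.

(** The sigma-algebra is generated by the coordinates, and an open set is the union of the countably
    many cubes with rational centre and half-width 1/(k+1) that it contains. *)
Lemma open_measurable_cV n (U : set 'cV[R]_n) : open U -> measurable U.
Proof.
move=> oU.
pose B (p : 'cV[rat]_n * nat) : set 'cV[R]_n :=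
  \bigcap_i [set x | `|x i 0 - ratr (p.1 i 0)| < p.2.+1%:R^-1].
have mB p : measurable (B p).
  apply: fin_bigcap_measurable => [|i _]; first exact: finite_finset.
  rewrite [X in measurable X](_ : _ =
      setT `&` cV_coord i @^-1` ball (ratr (p.1 i 0) : R) p.2.+1%:R^-1).
    by apply: measurable_cV_coord => //; exact: measurable_ball.
  by rewrite setTI; apply/seteqP; split => x /=; rewrite /ball/= /cV_coord distrC.
rewrite (_ : U = \bigcup_(p in [set: 'cV[rat]_n * nat])
    (if `[< B p `<=` U >] then B p else set0)).
  apply: countable_bigcupT_measurable; first exact: countableP.
  by move=> p; case: ifP.
apply/seteqP; split => [x Ux|x [p _]]; last first.
  by case: asboolP => // pU; exact: pU.
have := oU; rewrite openE => /(_ _ Ux) /nbhs_ballP[e /= e0 xeU].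
(* Two points of a cube of half-width below e/2 are at distance below e, so a cube that contains [x]
   lies in the ball of radius [e] at [x]. *)
have [k ke] : exists k : nat, k.+1%:R^-1 < e / 2.
  have e20 : 0 < e / 2 by exact: divr_gt0.
  exists (Num.truncn (e / 2)^-1).
  by rewrite invf_plt ?posrE ?invr_gt0// truncnS_gt.
have kgt0 : 0 < k.+1%:R^-1 :> R by rewrite invr_gt0.
have Hq i : exists q : rat, `|x i 0 - ratr q| < k.+1%:R^-1.
  have /rat_in_itvoo[q] : x i 0 - k.+1%:R^-1 < x i 0 + k.+1%:R^-1.
    by rewrite ltrD2l (lt_trans _ kgt0)// oppr_lt0.
  rewrite in_itv/= => /andP[q1 q2]; exists q.
  by rewrite ltr_distlC; apply/andP; split => //; rewrite -?ltrBlDr.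
have [q Hq'] := choice Hq.
exists (\col_i q i, k) => //; case: asboolP.
  by move=> _ i _ /=; rewrite mxE.
case=> y Hy; apply: xeU; split => // i j; rewrite ord1.
have /= := Hy i Logic.I; rewrite mxE => yq.
rewrite /ball/=; rewrite (_ : x i 0 - y i 0 = (x i 0 - ratr (q i)) - (y i 0 - ratr (q i))); last by ring.
rewrite (le_lt_trans (ler_normB _ _))// (splitr e) ltrD// ?(lt_trans _ ke)//.
Qed.

Lemma continuous_measurable_cV n (f : 'cV[R]_n -> R) :
  continuous f -> measurable_fun [set: 'cV[R]_n] (f : _ -> measurableTypeR R).
Proof.
move=> cf; apply: (measurability _ (RGenOpens.measurableE R)).
move=> _ [_ [a [b ->] <-]]; rewrite setTI; apply: open_measurable_cV.
by apply: open_comp; [move=> x _; exact: cf|exact: interval_open].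
Qed.

(** Product of unnormalised Cauchy densities: integrable on R^n, and multiplicative over a splitting
    of the coordinates. *)
Definition rho n (x : 'cV[R]_n) : R := \prod_(i < n) (1 + x i 0 ^+ 2)^-1.

Lemma rho_ge0 n (x : 'cV[R]_n) : 0 <= rho x.
Proof. by apply: prodr_ge0 => i _; rewrite invr_ge0 addr_ge0// sqr_ge0. Qed.

Lemma measurable_rho n : measurable_fun [set: 'cV[R]_n] (@rho n : _ -> measurableTypeR R).
Proof.
apply: (measurable_prod _ (h := fun i x => (1 + (x : 'cV[R]_n) i 0 ^+ 2)^-1)) => i _.
apply: (@measurableT_comp _ _ _ _ _ _ (fun t : R => (1 + t ^+ 2)^-1)); last first.
  exact: measurable_cV_coord.
by apply: continuous_measurable_fun; exact: continuous_oneDsqrV.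
Qed.

Lemma rho_cons n (a : R) (x : 'cV[R]_n) :
  rho (cons_cV (a, x)) = (1 + a ^+ 2)^-1 * rho x.
Proof.
rewrite /rho big_ord_recl; congr (_ * _).
  by have := cons_cVK (a, x) => -[-> _].
apply: eq_bigr => i _; congr ((1 + _ ^+ 2)^-1).
rewrite /cons_cV/= -[RHS](@col_mxEd _ 1 _ _ (const_mx a)).
by congr (col_mx _ _ _ _); exact/val_inj.
Qed.

Lemma integral_oneDsqrV_lty :
  (\int[lebesgue_measure]_x ((1 + x ^+ 2)^-1 : R)%:E < +oo)%E.
Proof.
rewrite ge0_symfun_integralT//=.
- rewrite (_ : [set x | _] = `[0, +oo[%classic); last first.
    by apply/seteqP; split => x/=; rewrite in_itv/= andbT.
  by rewrite (integral0y_oneDsqr R) -EFinM ltry.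
- by move=> x; rewrite invr_ge0 addr_ge0// sqr_ge0.
- exact: continuous_oneDsqrV.
- by move=> x/=; rewrite sqrrN.
Qed.

Lemma integral_rho_lty n : (\int[leb n]_x (rho x)%:E < +oo)%E.
Proof.
elim: n => [|n ih].
  rewrite ge0_integral_leb0 ?ltry//.
  by apply/measurable_EFinP; exact: measurable_rho.
rewrite ge0_integral_lebS; last 2 first.
- by apply/measurable_EFinP; exact: measurable_rho.
- by move=> x; rewrite lee_fin rho_ge0.
under eq_integral => a _.
  under eq_integral do rewrite rho_cons EFinM.
  rewrite ge0_integralZl//; last 3 first.
  - by apply/measurable_EFinP; exact: measurable_rho.
  - by move=> x _; rewrite lee_fin rho_ge0.
  - by rewrite lee_fin invr_ge0 addr_ge0// sqr_ge0.
  over.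
rewrite ge0_integralZr//.
- rewrite lte_mul_pinfty//.
  + by apply: integral_ge0 => x _; rewrite lee_fin invr_ge0 addr_ge0// sqr_ge0.
  + rewrite ge0_fin_numE ?integral_oneDsqrV_lty//.
    by apply: integral_ge0 => x _; rewrite lee_fin invr_ge0 addr_ge0// sqr_ge0.
- apply/measurable_EFinP; apply: (@continuous_measurable_fun R (fun x => (1 + x ^+ 2)^-1)).
  exact: continuous_oneDsqrV.
- by move=> x _; rewrite lee_fin invr_ge0 addr_ge0// sqr_ge0.
- by apply: integral_ge0 => x _; rewrite lee_fin rho_ge0.
Qed.

Lemma integrable_rho n : (leb n).-integrable setT (EFin \o @rho n).
Proof.
apply/integrableP; split; first by apply/measurable_EFinP; exact: measurable_rho.
under eq_integral do rewrite /= ger0_norm ?rho_ge0//.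
exact: integral_rho_lty.
Qed.

Lemma coord_le_norm n (x : 'cV[R]_n) i : `|x i 0| <= `|x|.
Proof.
rewrite [leRHS]mx_normrE.
exact: (le_bigmax _ (fun ij : 'I_n * 'I_1 => `|x ij.1 ij.2|) (i, 0)).
Qed.

(** The norm is the sup norm, so each factor satisfies 1 + x_i^2 <= (1 + |x|)^2. Decay of order 2n
    in the norm therefore yields the majorant [rho]. *)
Lemma rho_lower n (x : 'cV[R]_n) : (1 + `|x|) ^- (n.*2) <= rho x.
Proof.
have -> : (1 + `|x|) ^- n.*2 = \prod_(i < n) ((1 + `|x|) ^+ 2)^-1.
  by rewrite prodr_const card_ord exprVn -mul2n exprM.
apply: ler_prod => i _; rewrite invr_ge0 exprn_ge0 ?addr_ge0//=.
rewrite lef_pV2 ?posrE ?exprn_gt0 ?ltr_wpDr ?sqr_ge0//.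
have xi := coord_le_norm x i.
rewrite -[x i 0 ^+ 2]real_normK ?num_real// sqrrD expr1n mul1r.
by rewrite -addrA lerD2l (le_trans _ (ler_wpDl _ (lexx _)))// ?lerXn2r ?nnegrE// mulrn_wge0.
Qed.

End cV_functions.

(** * Complex-valued integrals *)

Section complex_integrals.
Context (R : realType).
Local Notation Re := complex.Re.
Local Notation Im := complex.Im.
Implicit Types z w : R[i].

Lemma cReM z w : Re (z * w) = Re z * Re w - Im z * Im w.
Proof. by case: z; case: w. Qed.
Lemma cImM z w : Im (z * w) = Re z * Im w + Im z * Re w.
Proof. by case: z; case: w => a b c d /=; rewrite [c * b + _]addrC. Qed.
Lemma cReD z w : Re (z + w) = Re z + Re w.
Proof. by case: z; case: w. Qed.
Lemma cImD z w : Im (z + w) = Im z + Im w.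
Proof. by case: z; case: w. Qed.
Lemma cReN z : Re (- z) = - Re z.
Proof. by case: z. Qed.
Lemma cImN z : Im (- z) = - Im z.
Proof. by case: z. Qed.
Lemma cReJ z : Re (z^*)%C = Re z.
Proof. by case: z. Qed.
Lemma cImJ z : Im (z^*)%C = - Im z.
Proof. by case: z. Qed.
Definition ReImE := (cReM, cImM, cReD, cImD, cReN, cImN, cReJ, cImJ).

Lemma complex_ext z w : Re z = Re w -> Im z = Im w -> z = w.
Proof. by case: z; case: w => a b c d /= -> ->. Qed.

(** The sum norm takes values in [R], whereas the norm of [R[i]] takes values in [R[i]]; it bounds
    both parts and is submultiplicative. *)
Definition norm1c z : R := `|Re z| + `|Im z|.

Lemma norm1c_ge0 z : 0 <= norm1c z.
Proof. by rewrite addr_ge0. Qed.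

Lemma norm1c_geRe z : `|Re z| <= norm1c z.
Proof. by rewrite lerDl. Qed.

Lemma norm1c_geIm z : `|Im z| <= norm1c z.
Proof. by rewrite lerDr. Qed.

Lemma norm1cM z w : norm1c (z * w) <= norm1c z * norm1c w.
Proof.
rewrite /norm1c !ReImE.
rewrite (le_trans (lerD (ler_normB _ _) (ler_normD _ _)))// !normrM.
lra.
Qed.

Lemma norm1cD z w : norm1c (z + w) <= norm1c z + norm1c w.
Proof.
rewrite /norm1c !ReImE (le_trans (lerD (ler_normD _ _) (ler_normD _ _)))//.
lra.
Qed.

Lemma norm1cJ z : norm1c (z^*)%C = norm1c z.
Proof. by rewrite /norm1c !ReImE normrN. Qed.

Lemma expiD (s t : R) : expi (s + t) = expi s * expi t.
Proof.
apply: complex_ext; rewrite !ReImE/= ?cosD ?sinD//.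
by rewrite addrC [X in _ = X + _]mulrC [X in _ = _ + X]mulrC [in RHS]addrC; ring.
Qed.

Lemma expi0 : expi 0 = 1 :> R[i].
Proof. by apply: complex_ext; rewrite /= ?cos0 ?sin0. Qed.

Lemma expiJ (t : R) : ((expi t)^*)%C = expi (- t).
Proof. by apply: complex_ext; rewrite /= ?cosN ?sinN. Qed.

Lemma norm1c_expi (t : R) : norm1c (expi t) <= 2.
Proof.
by rewrite /norm1c/= -[2]/(1 + 1) lerD// ler_norml ?cos_geN1 ?cos_le1 ?sin_geN1 ?sin_le1.
Qed.

Definition cmeas n (F : 'cV[R]_n -> R[i]) : Prop :=
  measurable_fun [set: 'cV[R]_n] (fun x => Re (F x) : measurableTypeR R) /\
  measurable_fun [set: 'cV[R]_n] (fun x => Im (F x) : measurableTypeR R).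

Lemma cmeasM n (F G : 'cV[R]_n -> R[i]) : cmeas F -> cmeas G ->
  cmeas (fun x => F x * G x).
Proof.
move=> [F1 F2] [G1 G2]; split.
- rewrite (_ : (fun _ => _) = (fun x => Re (F x) * Re (G x) - Im (F x) * Im (G x))).
    by apply: measurable_funB; apply: measurable_funM.
  by apply/funext => x; rewrite cReM.
- rewrite (_ : (fun _ => _) = (fun x => Re (F x) * Im (G x) + Im (F x) * Re (G x))).
    by apply: measurable_funD; apply: measurable_funM.
  by apply/funext => x; rewrite cImM.
Qed.

Lemma cmeasD n (F G : 'cV[R]_n -> R[i]) : cmeas F -> cmeas G ->
  cmeas (fun x => F x + G x).
Proof.
move=> [F1 F2] [G1 G2]; split.
- rewrite (_ : (fun _ => _) = (fun x => Re (F x) + Re (G x))).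
    exact: measurable_funD.
  by apply/funext => x; rewrite cReD.
- rewrite (_ : (fun _ => _) = (fun x => Im (F x) + Im (G x))).
    exact: measurable_funD.
  by apply/funext => x; rewrite cImD.
Qed.

Lemma cmeas_cst n z : cmeas (fun _ : 'cV[R]_n => z).
Proof. by split; exact: measurable_cst. Qed.

Lemma cmeasJ n (F : 'cV[R]_n -> R[i]) : cmeas F -> cmeas (fun x => ((F x)^*)%C).
Proof.
move=> [F1 F2]; split.
- rewrite (_ : (fun _ => _) = (fun x => Re (F x)))//.
  by apply/funext => x; rewrite cReJ.
- rewrite (_ : (fun _ => _) = (fun x => - Im (F x))).
    exact: measurableT_comp.
  by apply/funext => x; rewrite cImJ.
Qed.

Lemma cmeas_comp m n (F : 'cV[R]_n -> R[i]) (h : 'cV[R]_m -> 'cV[R]_n) :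
  cmeas F -> measurable_fun setT h -> cmeas (F \o h).
Proof. by move=> [F1 F2] mh; split; [exact: (measurableT_comp F1 mh)|exact: (measurableT_comp F2 mh)]. Qed.

Lemma cmeas_expi n (t : 'cV[R]_n -> R) :
  measurable_fun [set: 'cV[R]_n] (t : _ -> measurableTypeR R) ->
  cmeas (fun x => expi (t x)).
Proof.
move=> mt; split.
- apply: (@measurableT_comp _ _ _ _ _ _ (cos : R -> R)) => //.
  by apply: continuous_measurable_fun; exact: continuous_cos.
- apply: (@measurableT_comp _ _ _ _ _ _ (sin : R -> R)) => //.
  by apply: continuous_measurable_fun; exact: continuous_sin.
Qed.

(* The majorant rho is a product over the coordinates, so that this form of
   integrability passes to the slices of F. *)
Definition rdom n (F : 'cV[R]_n -> R[i]) : Prop :=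
  cmeas F /\ exists M, forall x, norm1c (F x) <= M * rho x.

Lemma rho_le1 n (x : 'cV[R]_n) : rho x <= 1.
Proof.
apply: prodr_ile1 => i _; rewrite invr_ge0 addr_ge0 ?sqr_ge0//=.
by rewrite invf_le1 ?lerDl ?sqr_ge0// ltr_wpDr ?sqr_ge0.
Qed.

Lemma rho_gt0 n (x : 'cV[R]_n) : 0 < rho x.
Proof. by apply: prodr_gt0 => i _; rewrite invr_gt0 ltr_wpDr ?sqr_ge0. Qed.

Lemma majorant_ge0 n (F : 'cV[R]_n -> R[i]) M :
  (forall x, norm1c (F x) <= M * rho x) -> 0 <= M.
Proof.
move=> FM; rewrite -(pmulr_lge0 _ (rho_gt0 (0 : 'cV[R]_n))).
exact: le_trans (norm1c_ge0 _) (FM 0).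
Qed.

Lemma rho_col m n (x : 'cV[R]_m) (y : 'cV[R]_n) :
  rho (col_mx x y) = rho x * rho y.
Proof.
rewrite /rho big_split_ord/=; congr (_ * _); apply: eq_bigr => i _.
  by rewrite col_mxEu.
by rewrite col_mxEd.
Qed.

Lemma integrable_le_rho n (f : 'cV[R]_n -> R) M :
  measurable_fun [set: 'cV[R]_n] (f : _ -> measurableTypeR R) ->
  (forall x, `|f x| <= M * rho x) ->
  (leb n).-integrable setT (EFin \o f).
Proof.
move=> mf fM.
apply: (@le_integrable _ _ _ _ _ measurableT _ (fun x => M%:E * (rho x)%:E)%E).
- exact/measurable_EFinP.
- move=> x _; rewrite /= lee_fin (le_trans (fM x))// ler_norm//.
- exact/integrableZl/integrable_rho.
Qed.

Lemma rdom_in_L1 n (F : 'cV[R]_n -> R[i]) : rdom F -> in_L1 F.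
Proof.
move=> [[F1 F2] [M FM]]; split; apply: (@integrable_le_rho _ _ M) => // x.
  exact: (le_trans (norm1c_geRe _) (FM x)).
exact: (le_trans (norm1c_geIm _) (FM x)).
Qed.

Lemma rdom_in_L2 n (F : 'cV[R]_n -> R[i]) : rdom F -> in_L2 F.
Proof.
move=> [[F1 F2] [M FM]]; split => //.
have M0 := majorant_ge0 FM.
have mf : measurable_fun [set: 'cV[R]_n]
    ((fun x => Re (F x) ^+ 2 + Im (F x) ^+ 2) : _ -> measurableTypeR R).
  by apply: measurable_funD; apply: measurable_funX.
have /integrableP[_] : (leb n).-integrable setT
    (EFin \o (fun x => Re (F x) ^+ 2 + Im (F x) ^+ 2)).
  apply: (@integrable_le_rho _ _ (M ^+ 2)) => // x.
  rewrite ger0_norm ?addr_ge0 ?sqr_ge0//.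
  apply: (@le_trans _ _ (norm1c (F x) ^+ 2)).
    rewrite -[Re _ ^+ 2]real_normK ?num_real// -[Im _ ^+ 2]real_normK ?num_real//.
    by rewrite sqrrD addrAC lerDl mulrn_wge0// mulr_ge0.
  apply: (@le_trans _ _ ((M * rho x) ^+ 2)).
    by rewrite lerXn2r ?nnegrE ?norm1c_ge0// ?mulr_ge0 ?M0 ?rho_ge0.
  rewrite exprMn ler_wpM2l ?sqr_ge0// expr2 ler_piMr ?rho_ge0 ?rho_le1//.
apply: le_lt_trans; rewrite le_eqVlt; apply/orP; left; apply/eqP.
apply: eq_integral => x _; rewrite /= ger0_norm// addr_ge0 ?sqr_ge0//.
Qed.

Lemma rdomMb n (F G : 'cV[R]_n -> R[i]) b : rdom F -> cmeas G ->
  (forall x, norm1c (G x) <= b) -> rdom (fun x => F x * G x).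
Proof.
move=> [mF [M FM]] mG Gb; split; first exact: cmeasM.
exists (M * b) => x; rewrite (le_trans (norm1cM _ _))//.
by rewrite mulrAC ler_pM ?norm1c_ge0.
Qed.

Lemma rdomZ n (F : 'cV[R]_n -> R[i]) z : rdom F -> rdom (fun x => z * F x).
Proof.
move=> dF; rewrite (_ : (fun _ => _) = (fun x => F x * z)).
  by apply: (rdomMb (b := norm1c z) dF); [exact: cmeas_cst|].
by apply/funext => x; rewrite mulrC.
Qed.

Lemma rdomM_expi n (F : 'cV[R]_n -> R[i]) (t : 'cV[R]_n -> R) :
  measurable_fun [set: 'cV[R]_n] (t : _ -> measurableTypeR R) ->
  rdom F -> rdom (fun x => F x * expi (t x)).
Proof.
move=> mt dF; apply: (rdomMb (b := 2) dF); first exact: cmeas_expi.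
by move=> x; exact: norm1c_expi.
Qed.

Lemma rdomD n (F G : 'cV[R]_n -> R[i]) : rdom F -> rdom G ->
  rdom (fun x => F x + G x).
Proof.
move=> [mF [M FM]] [mG [N GN]]; split; first exact: cmeasD.
by exists (M + N) => x; rewrite (le_trans (norm1cD _ _))// mulrDl lerD.
Qed.

Lemma rdomJ n (F : 'cV[R]_n -> R[i]) : rdom F -> rdom (fun x => ((F x)^*)%C).
Proof.
move=> [mF [M FM]]; split; first exact: cmeasJ.
by exists M => x; rewrite norm1cJ.
Qed.

Lemma rdom_coll m n (F : 'cV[R]_(m + n) -> R[i]) x :
  rdom F -> rdom (fun y : 'cV[R]_n => F (col_mx x y)).
Proof.
move=> [mF [M FM]]; split; first exact: (cmeas_comp mF (measurable_col_cVl x)).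
by exists (M * rho x) => y; rewrite -mulrA -rho_col.
Qed.

Lemma cintZ n (F : 'cV[R]_n -> R[i]) z : in_L1 F ->
  cint (fun x => z * F x) = z * cint F.
Proof.
move=> [F1 F2]; apply: complex_ext; rewrite !ReImE/=.
- under eq_Rintegral do rewrite cReM.
  rewrite RintegralB ?RintegralZl//; first exact: (integrableZl _ _ F1).
  exact: (integrableZl _ _ F2).
- under eq_Rintegral do rewrite cImM.
  rewrite RintegralD ?RintegralZl//; first exact: (integrableZl _ _ F2).
  exact: (integrableZl _ _ F1).
Qed.

Lemma cintZr n (F : 'cV[R]_n -> R[i]) z : in_L1 F ->
  cint (fun x => F x * z) = cint F * z.
Proof.
move=> iF; rewrite [RHS]mulrC -cintZ//; congr cint.
by apply/funext => x; rewrite mulrC.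
Qed.

Lemma cintB n (F G : 'cV[R]_n -> R[i]) : in_L1 F -> in_L1 G ->
  cint (fun x => F x - G x) = cint F - cint G.
Proof.
move=> [F1 F2] [G1 G2]; apply: complex_ext; rewrite !ReImE/=.
- by under eq_Rintegral do rewrite !ReImE; rewrite RintegralB.
- by under eq_Rintegral do rewrite !ReImE; rewrite RintegralB.
Qed.

Lemma cintJ n (F : 'cV[R]_n -> R[i]) : in_L1 F ->
  cint (fun x => ((F x)^*)%C) = ((cint F)^*)%C.
Proof.
move=> [F1 F2]; apply: complex_ext; rewrite !ReImE/=.
- by under eq_Rintegral do rewrite cReJ.
- under eq_Rintegral do rewrite cImJ -mulN1r.
  by rewrite RintegralZl// mulN1r.
Qed.

Lemma cint_affine n (a : R) (b : 'cV[R]_n) (F : 'cV[R]_n -> R[i]) :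
  a = 1 \/ a = -1 -> cmeas F -> cint (fun x => F (a *: x + b)) = cint F.
Proof.
move=> a1 [F1 F2]; congr Complex; congr fine.
- apply: (integral_leb_affine b a1 (f := fun x => (Re (F x))%:E)).
  exact/measurable_EFinP.
- apply: (integral_leb_affine b a1 (f := fun x => (Im (F x))%:E)).
  exact/measurable_EFinP.
Qed.

Lemma cint_col m n (F : 'cV[R]_(m + n) -> R[i]) : in_L1 F ->
  cint F = cint (fun x => cint (fun y => F (col_mx x y))).
Proof. by move=> [F1 F2]; congr Complex; rewrite Rintegral_leb_col. Qed.

Lemma cint_col_sym m n (F : 'cV[R]_(m + n) -> R[i]) : in_L1 F ->
  cint F = cint (fun y => cint (fun x => F (col_mx x y))).
Proof. by move=> [F1 F2]; congr Complex; rewrite Rintegral_leb_col_sym. Qed.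

Lemma cmeas_cint m n (F : 'cV[R]_(m + n) -> R[i]) : cmeas F ->
  cmeas (fun x : 'cV[R]_m => cint (fun y => F (col_mx x y))).
Proof.
move=> [F1 F2]; split.
- exact: (measurable_Rintegral_col (f := fun x => Re (F x))).
- exact: (measurable_Rintegral_col (f := fun x => Im (F x))).
Qed.

Lemma ae_eq_cint n (F G : 'cV[R]_n -> R[i]) : cmeas F -> cmeas G ->
  {ae leb n, forall x, F x = G x} -> cint F = cint G.
Proof.
move=> [F1 F2] [G1 G2] FG; congr Complex; congr fine; apply: ae_eq_integral => //.
- exact/measurable_EFinP.
- exact/measurable_EFinP.
- by apply: filterS FG => x ->.
- exact/measurable_EFinP.
- exact/measurable_EFinP.
- by apply: filterS FG => x ->.
Qed.

(** The factor 2 comes from estimating the real and the imaginary part separately. *)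
Lemma norm1c_cint_le n (F : 'cV[R]_n -> R[i]) M : cmeas F ->
  (forall x, norm1c (F x) <= M * rho x) ->
  norm1c (cint F) <= 2 * M * Rintegral (leb n) setT (@rho R n).
Proof.
move=> mF FM.
have irho := integrable_rho R n.
have H (f : 'cV[R]_n -> R) :
    measurable_fun [set: 'cV[R]_n] (f : _ -> measurableTypeR R) ->
    (forall x, `|f x| <= M * rho x) ->
    `|Rintegral (leb n) setT f| <= M * Rintegral (leb n) setT (@rho R n).
  move=> mf fM; have fi := integrable_le_rho mf fM.
  rewrite (le_trans (le_normr_Rintegral _ fi))// -RintegralZl//.
  apply: le_Rintegral => //; first exact: integrable_norm fi.
  exact: (integrableZl _ _ irho).
case: mF => F1 F2; rewrite -mulrA -[2]/(1 + 1) mulrDl mul1r lerD//=; apply: H => // x.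
  exact: (le_trans (norm1c_geRe _) (FM x)).
exact: (le_trans (norm1c_geIm _) (FM x)).
Qed.

Lemma cint_dominated n (F_ : nat -> 'cV[R]_n -> R[i]) (F : 'cV[R]_n -> R[i]) M :
  (forall k, cmeas (F_ k)) -> cmeas F ->
  (forall x, Re (F_ k x) @[k --> \oo] --> Re (F x)) ->
  (forall x, Im (F_ k x) @[k --> \oo] --> Im (F x)) ->
  (forall k x, norm1c (F_ k x) <= M * rho x) ->
  (Re (cint (F_ k)) @[k --> \oo] --> Re (cint F)) /\
  (Im (cint (F_ k)) @[k --> \oo] --> Im (cint F)).
Proof.
move=> mF_ mF Rcvg Icvg FM.
have H (f_ : nat -> 'cV[R]_n -> R) (f : 'cV[R]_n -> R) :
    (forall k, measurable_fun [set: 'cV[R]_n] (f_ k : _ -> measurableTypeR R)) ->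
    measurable_fun [set: 'cV[R]_n] (f : _ -> measurableTypeR R) ->
    (forall x, f_ k x @[k --> \oo] --> f x) ->
    (forall k x, `|f_ k x| <= M * rho x) ->
    Rintegral (leb n) setT (f_ k) @[k --> \oo] --> Rintegral (leb n) setT f.
  move=> mf_ mf fcvg fM.
  have [] := @dominated_convergence _ _ R (leb n) setT measurableT
    (fun k x => (f_ k x)%:E) (fun x => (f x)%:E) (fun x => (M * rho x)%:E).
  - by move=> k; apply/measurable_EFinP; exact: mf_.
  - exact/measurable_EFinP.
  - by apply: aeW => x _; apply: cvg_EFin; [exact: nearW|exact: fcvg].
  - exact: (integrableZl _ M (integrable_rho R n)).
  - by apply: aeW => x k _; rewrite /= lee_fin.
  - move=> fi _ fcv; apply: fine_cvg.
    by rewrite /Rintegral fineK//; exact: integrable_fin_num.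
split; apply: H.
- by move=> k; exact: (mF_ k).1.
- exact: mF.1.
- exact: Rcvg.
- by move=> k x; exact: (le_trans (norm1c_geRe _) (FM k x)).
- by move=> k; exact: (mF_ k).2.
- exact: mF.2.
- exact: Icvg.
- by move=> k x; exact: (le_trans (norm1c_geIm _) (FM k x)).
Qed.

End complex_integrals.

(** * Fourier transforms *)

Section fourier_derivative.
Context (R : realType).
Local Notation Re := complex.Re.
Local Notation Im := complex.Im.

Lemma dotE n (x y : 'cV[R]_n) : dot x y = \sum_(i < n) x i 0 * y i 0.
Proof. by rewrite /dot mxE; apply: eq_bigr => i _; rewrite mxE. Qed.

Lemma dotC n (x y : 'cV[R]_n) : dot x y = dot y x.
Proof. by rewrite !dotE; apply: eq_bigr => i _; rewrite mulrC. Qed.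

Lemma dotDr n (x y z : 'cV[R]_n) : dot x (y + z) = dot x y + dot x z.
Proof. by rewrite /dot mulmxDr mxE. Qed.

Lemma dotZr n a (x y : 'cV[R]_n) : dot x (a *: y) = a * dot x y.
Proof. by rewrite /dot -scalemxAr mxE. Qed.

Lemma dotNr n (x y : 'cV[R]_n) : dot x (- y) = - dot x y.
Proof. by rewrite -scaleN1r dotZr mulN1r. Qed.

Lemma dot_delta n (x : 'cV[R]_n) i : dot x (delta_mx i 0) = x i 0.
Proof.
rewrite dotE (bigD1 i)//= mxE !eqxx mulr1 big1 ?addr0// => j ji.
by rewrite mxE (negbTE ji) mulr0.
Qed.

Lemma dot_col m n (x x' : 'cV[R]_m) (y y' : 'cV[R]_n) :
  dot (col_mx x y) (col_mx x' y') = dot x x' + dot y y'.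
Proof. by rewrite /dot tr_col_mx mul_row_col mxE. Qed.

Lemma measurable_dot n d (T : measurableType d) (x y : T -> 'cV[R]_n) :
  measurable_fun setT x -> measurable_fun setT y ->
  measurable_fun setT ((fun t => dot (x t) (y t)) : _ -> measurableTypeR R).
Proof.
move=> mx my.
rewrite (_ : (fun _ => _) = (fun t => \sum_(i < n) x t i 0 * y t i 0)); last first.
  by apply/funext => t; rewrite dotE.
apply: (measurable_sum _ (h := fun i t => x t i 0 * y t i 0)) => i.
apply: measurable_funM.
- exact: (measurableT_comp (measurable_cV_coord i) mx).
- exact: (measurableT_comp (measurable_cV_coord i) my).
Qed.

Lemma measurable_dotr n (x : 'cV[R]_n) (c : R) :
  measurable_fun [set: 'cV[R]_n]
    ((fun t => c * dot x t) : _ -> measurableTypeR R).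
Proof.
by apply: measurable_funM => //; apply: measurable_dot.
Qed.

Lemma rdom_fourier_arg n (k : 'cV[R]_n -> R[i]) u :
  rdom k -> rdom (fun t => k t * expi (- (2 * pi * dot u t))).
Proof.
apply: rdomM_expi; rewrite (_ : (fun _ => _) = (fun t => - (2 * pi) * dot u t)).
  exact: measurable_dotr.
by apply/funext => t; rewrite mulNr.
Qed.

Lemma norm_delta_le1 n (i : 'I_n) : `|delta_mx i 0 : 'cV[R]_n| <= 1.
Proof.
rewrite [leLHS]mx_normrE; apply/bigmax_leP; split => // -[a b] _ /=.
by rewrite mxE; case: (_ && _); rewrite ?normr1// normr0.
Qed.

Lemma is_derive_line n (f : 'cV[R]_n -> R) y e t df :
  is_derive (y + t *: e) e f df -> is_derive t (1 : R) (fun s => f (y + s *: e)) df.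
Proof.
move=> [df1 df2].
have E : (fun h : R => h^-1 *: (((fun s => f (y + s *: e)) \o shift t) (h *: (1 : R)) -
      f (y + t *: e))) =
    (fun h => h^-1 *: ((f \o shift (y + t *: e)) (h *: e) - f (y + t *: e))).
  apply/funext => h /=; congr (_ *: (f _ - _)).
  by rewrite [h *: 1]mulr1 scalerDl addrCA.
by split; [rewrite /derivable E|rewrite /derive E].
Qed.

(** Mean value theorem on the segment from [y] to [y + s *: e]. It bounds the difference quotients
    as dominated convergence requires. *)
Lemma increment_le n (f f' : 'cV[R]_n -> R) e y s M :
  0 < s -> (forall y, is_derive y e f (f' y)) ->
  (forall t, 0 <= t <= s -> `|f' (y + t *: e)| <= M) ->
  `|f (y + s *: e) - f y| <= M * s.
Proof.
move=> s0 df fM.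
have dg t : is_derive t (1 : R) (fun s => f (y + s *: e)) (f' (y + t *: e)).
  exact: is_derive_line.
have [] := @MVT R (fun s => f (y + s *: e)) (fun t => f' (y + t *: e)) 0 s s0.
- apply: continuous_subspaceT => t.
  by apply: differentiable_continuous; apply/derivable1_diffP; exact: (@ex_derive _ _ _ _ _ _ _ (dg t)).
move=> c; rewrite in_itv/= => /andP[c0 cs]; rewrite scale0r addr0 subr0 => ->.
by rewrite normrM (gtr0_norm s0) ler_pM2r// fM// !ltW.
Qed.

(** The steps run through [harmonic k], that is 1/(k+1), because dominated convergence is applied to
    sequences. *)
Lemma cvg_increment n (f : 'cV[R]_n -> R) y e df :
  is_derive y e f df ->
  (harmonic k : R)^-1 * (f (y + harmonic k *: e) - f y) @[k --> \oo] --> df.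
Proof.
move=> [df1 df2].
have {df1}: h^-1 *: ((f \o shift y) (h *: e) - f y) @[h --> 0^'] --> df.
  by rewrite -df2; exact: df1.
move=> /cvgr_dnbhsP /(_ (@harmonic R)) H.
have {}H := H (conj (fun k => lt0r_neq0 (harmonic_gt0 k)) cvg_harmonic).
apply: cvg_trans H; apply: near_eq_cvg; apply: nearW => k /=.
by rewrite [_ + y]addrC.
Qed.

(** Peetre's inequality in each coordinate, 1 + x^2 <= 2 (1 + v^2) (1 + (x + v)^2), multiplied over
    the [n] coordinates. *)
Lemma rho_shift n (x v : 'cV[R]_n) B : 0 <= B -> `|v| <= B ->
  rho (x + v) <= (2 * (1 + B ^+ 2)) ^+ n * rho x.
Proof.
move=> B0 vB; rewrite -[n in X in X * _](card_ord n) -prodr_const /rho -big_split/=.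
apply: ler_prod => i _; rewrite invr_ge0 addr_ge0 ?sqr_ge0//= mxE.
rewrite ler_pdivlMr ?ltr_wpDr ?sqr_ge0// mulrC ler_pdivrMr ?ltr_wpDr ?sqr_ge0//.
have vB2 : v i 0 ^+ 2 <= B ^+ 2.
  rewrite -[leLHS]real_normK ?num_real// lerXn2r ?nnegrE//.
  exact: le_trans (coord_le_norm _ _) vB.
have := sqr_ge0 (x i 0 + v i 0 + v i 0); have := sqr_ge0 ((x i 0 + v i 0) * B).
have := sqr_ge0 (x i 0 + v i 0); nra.
Qed.

Lemma rdom_shift n (F : 'cV[R]_n -> R[i]) v : rdom F -> rdom (fun x => F (x + v)).
Proof.
move=> [mF [M FM]]; split.
  have := cmeas_comp mF (measurable_affine_cV 1 v).
  by congr cmeas; apply/funext => y /=; rewrite scale1r.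
have M0 := majorant_ge0 FM.
exists (M * (2 * (1 + `|v| ^+ 2)) ^+ n) => x.
by rewrite (le_trans (FM _))// -mulrA ler_wpM2l// rho_shift.
Qed.

(** Translation invariance of the integral turns the shift of [k] by [s] along the i-th axis into
    the factor e^{2 pi i s u_i}. *)
Lemma fourier_increment n (k : 'cV[R]_n -> R[i]) (i : 'I_n) (s : R) u :
  rdom k ->
  fourier (fun y => (s^-1)%:C%C * (k (y + s *: delta_mx i 0) - k y)) u =
  (s^-1)%:C%C * (expi (2 * pi * (s * u i 0)) - 1) * fourier k u.
Proof.
move=> dk; set e := delta_mx i 0.
pose E y := expi (- (2 * pi * dot u y)).
have mE F : rdom F -> rdom (fun y => F y * E y) by exact: rdom_fourier_arg.
have H1 : cint (fun y => k (y + s *: e) * E y) = expi (2 * pi * (s * u i 0)) * fourier k u.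
  rewrite /fourier -cintZ; last exact/rdom_in_L1/mE.
  pose G t := expi (2 * pi * (s * u i 0)) * (k t * E t).
  have mG : cmeas G by have [] := rdomZ (expi (2 * pi * (s * u i 0))) (mE _ dk).
  rewrite -(cint_affine (s *: e) (or_introl erefl) mG); congr cint.
  apply/funext => y; rewrite /G scale1r mulrCA; congr (_ * _).
  rewrite /E -expiD; congr expi.
  rewrite dotDr dotZr dot_delta; ring.
have dks : rdom (fun y => k (y + s *: e)) by exact: rdom_shift.
rewrite /fourier -/E.
rewrite (_ : (fun _ => _) = (fun y => (s^-1)%:C%C * (k (y + s *: e) * E y - k y * E y))); last first.
  by apply/funext => y; rewrite -mulrBl mulrA.
rewrite cintZ ?cintB; try exact/rdom_in_L1/mE.
  by rewrite H1 -[cint (fun x => k x * E x)]/(fourier k u) -/(fourier k u); ring.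
have := rdomD (mE _ dks) (rdomZ (-1) (mE _ dk)).
move=> /rdom_in_L1; congr in_L1; apply/funext => y /=.
by rewrite mulN1r.
Qed.

(** The derivative of e^{iat} at 0 is ia, read on the two parts along the steps [harmonic k]. *)
Lemma cvg_expi_increment (a : R) :
  (complex.Re ((harmonic k)^-1%:C%C * (expi (a * harmonic k) - 1)) @[k --> \oo] --> 0) /\
  (complex.Im ((harmonic k)^-1%:C%C * (expi (a * harmonic k) - 1)) @[k --> \oo] --> a).
Proof.
have H (f : R -> R) df : is_derive (0:R) (1:R) (fun t : R => f (a * t)) df ->
    (harmonic k)^-1 * (f (a * harmonic k) - f 0) @[k --> \oo] --> df.
  move=> [df1 df2].
  have {df1}: h^-1 *: (((fun t : R => f (a * t)) \o shift 0) (h *: 1) - f (a * 0)) @[h --> 0^'] --> df.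
    by rewrite -df2; exact: df1.
  move=> /cvgr_dnbhsP /(_ (@harmonic R)) H.
  have {}H := H (conj (fun k => lt0r_neq0 (harmonic_gt0 k)) cvg_harmonic).
  apply: cvg_trans H; apply: near_eq_cvg; apply: nearW => k /=.
  by rewrite addr0 [_ *: 1]mulr1 mulr0.
have da (t : R) : is_derive t (1 : R) (fun t : R => a * t) a.
  have := @is_deriveZ R R^o R^o id a t 1 1 (is_derive_id _ _).
  by rewrite [a *: _]mulr1.
split.
- have D : is_derive (0:R) (1:R) (fun t : R => cos (a * t)) 0.
    have := is_derive1_comp (is_derive_cos (a * 0)) (da 0).
    by rewrite mulr0 sin0 oppr0 mul0r.
  apply: cvg_trans (H _ _ D); apply: near_eq_cvg; apply: nearW => k /=.
  by rewrite cos0 mul0r subr0.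
- have D : is_derive (0:R) (1:R) (fun t : R => sin (a * t)) a.
    have := is_derive1_comp (is_derive_sin (a * 0)) (da 0).
    by rewrite mulr0 cos0 mul1r.
  apply: cvg_trans (H _ _ D); apply: near_eq_cvg; apply: nearW => k /=.
  by rewrite sin0 !subr0 mul0r addr0.
Qed.

(* Instead of integrating by parts, let s tend to 0 in fourier_increment. *)
Lemma fourier_derive n (k k' : 'cV[R]_n -> R[i]) (i : 'I_n) u :
  rdom k -> rdom k' ->
  (forall y, is_derive y (delta_mx i 0) (fun t => Re (k t)) (Re (k' y))) ->
  (forall y, is_derive y (delta_mx i 0) (fun t => Im (k t)) (Im (k' y))) ->
  fourier k' u = (0 +i* (2 * pi * u i 0))%C * fourier k u.
Proof.
move=> dk dk' Rd Id; pose e : 'cV[R]_n := delta_mx i 0.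
have [mk' [M kM]] := dk'.
have M0 := majorant_ge0 kM.
pose s j : R := harmonic j.
have s0 j : 0 < s j by exact: harmonic_gt0.
pose q j y := ((s j)^-1)%:C%C * (k (y + s j *: e) - k y).
pose E y := expi (- (2 * pi * dot u y)).
have mt : measurable_fun [set: 'cV[R]_n] ((fun y => - (2 * pi * dot u y)) : _ -> measurableTypeR R).
  rewrite (_ : (fun _ => _) = (fun t => - (2 * pi) * dot u t)); first exact: measurable_dotr.
  by apply/funext => t; rewrite mulNr.
have mE : cmeas E by exact: cmeas_expi.
have dq j : rdom (q j).
  apply: rdomZ; apply: rdomD; first exact: rdom_shift.
  by rewrite (_ : (fun _ => _) = (fun x => -1 * k x)); [exact: rdomZ|apply/funext => x; rewrite mulN1r].
have qRe j y : Re (q j y) = (s j)^-1 * (Re (k (y + s j *: e)) - Re (k y)).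
  by rewrite !ReImE /= mul0r subr0.
have qIm j y : Im (q j y) = (s j)^-1 * (Im (k (y + s j *: e)) - Im (k y)).
  by rewrite !ReImE /= mul0r addr0.
(* The steps are at most 1, so [rho_shift] with radius 1 provides one majorant for all the
   quotients. *)
pose C := M * (2 * (1 + 1 ^+ 2)) ^+ n.
have qb j y : norm1c (q j y) <= 2 * C * rho y.
  have B t : 0 <= t <= s j -> norm1c (k' (y + t *: e)) <= C * rho y.
    move=> /andP[t0 ts]; rewrite (le_trans (kM _))// /C -mulrA ler_wpM2l// rho_shift//.
    rewrite mx_normZ (ger0_norm t0) mulr_ile1 ?norm_delta_le1//.
    by rewrite (le_trans ts)// invf_le1 ?ler1n.
  have H (f f' : 'cV[R]_n -> R) : (forall y, is_derive y e f (f' y)) ->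
      (forall t, 0 <= t <= s j -> `|f' (y + t *: e)| <= C * rho y) ->
      `|(s j)^-1 * (f (y + s j *: e) - f y)| <= C * rho y.
    move=> df fC; rewrite normrM gtr0_norm ?invr_gt0// ler_pdivrMl// mulrC.
    exact: (increment_le (s0 j) df fC).
  rewrite /norm1c qRe qIm -mulrA mulr2n mulrDl mul1r; apply: lerD.
  - by apply: (H (fun t => Re (k t)) (fun t => Re (k' t))) => // t /B; apply: le_trans; exact: norm1c_geRe.
  - by apply: (H (fun t => Im (k t)) (fun t => Im (k' t))) => // t /B; apply: le_trans; exact: norm1c_geIm.
have [RL IL] : (Re (fourier (q j) u) @[j --> \oo] --> Re (fourier k' u)) /\
  (Im (fourier (q j) u) @[j --> \oo] --> Im (fourier k' u)).
  apply: (@cint_dominated _ _ _ _ (2 * C * 2)).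
  - by move=> j; apply: cmeasM => //; exact: (dq j).1.
  - exact: cmeasM.
  - move=> y; under eq_fun do rewrite cReM; rewrite cReM.
    apply: cvgB; apply: cvgMl.
      under eq_fun do rewrite qRe; exact: cvg_increment.
    under eq_fun do rewrite qIm; exact: cvg_increment.
  - move=> y; under eq_fun do rewrite cImM; rewrite cImM.
    apply: cvgD; apply: cvgMl.
      under eq_fun do rewrite qRe; exact: cvg_increment.
    under eq_fun do rewrite qIm; exact: cvg_increment.
  - move=> j y; rewrite (le_trans (norm1cM _ _))// [leRHS]mulrAC.
    by apply: ler_pM; rewrite ?norm1c_ge0//; exact: norm1c_expi.
(* The same quotients, transformed through [fourier_increment], tend to 2 pi i u_i times the
   transform of [k]; limits are unique. *)
have [Rp Ip] := cvg_expi_increment (2 * pi * u i 0).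
have qE j : fourier (q j) u =
    ((harmonic j)^-1)%:C%C * (expi (2 * pi * u i 0 * harmonic j) - 1) * fourier k u.
  rewrite fourier_increment//; congr (_ * (expi _ - _) * _); rewrite -/(s j); ring.
pose a j : R[i] := ((harmonic j)^-1)%:C%C * (expi (2 * pi * u i 0 * harmonic j) - 1).
have {RL}RL : Re (a j) * Re (fourier k u) - Im (a j) * Im (fourier k u) @[j --> \oo]
    --> Re (fourier k' u).
  by apply: cvg_trans RL; apply: near_eq_cvg; apply: nearW => j; rewrite qE cReM.
have {IL}IL : Re (a j) * Im (fourier k u) + Im (a j) * Re (fourier k u) @[j --> \oo]
    --> Im (fourier k' u).
  by apply: cvg_trans IL; apply: near_eq_cvg; apply: nearW => j; rewrite qE cImM.
apply: complex_ext.
- apply: (cvg_unique _ RL) => //; rewrite cReM.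
  by apply: cvgB; apply: cvgMl.
- apply: (cvg_unique _ IL) => //; rewrite cImM.
  by apply: cvgD; apply: cvgMl.
Qed.

Lemma cmeas_fourier2 d (F : 'cV[R]_(d + d) -> R[i]) :
  cmeas F -> cmeas (fourier2 F).
Proof.
move=> mF.
have mG : cmeas (fun w : 'cV[R]_((d + d) + d) =>
    F (col_mx (usubmx (usubmx w)) (dsubmx w)) *
    expi (- (2 * pi * dot (dsubmx (usubmx w)) (dsubmx w)))).
  apply: cmeasM.
    apply: (cmeas_comp mF (h := fun w => col_cV (usubmx (usubmx w), dsubmx w))).
    apply: (measurableT_comp (@measurable_col_cV R d d)).
    apply: measurable_fun_pair; last exact: measurable_dsubmx.
    exact: (measurableT_comp (@measurable_usubmx R d d) (@measurable_usubmx R (d + d) d)).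
  apply: cmeas_expi; apply: (measurableT_comp (@oppr_measurable R setT)).
  apply: measurable_funM => //; apply: measurable_dot.
    exact: (measurableT_comp (@measurable_dsubmx R d d) (@measurable_usubmx R (d + d) d)).
  exact: measurable_dsubmx.
have := cmeas_cint mG; congr cmeas; apply/funext => z; rewrite /fourier2; congr cint.
by apply/funext => y; rewrite !col_mxKu col_mxKd.
Qed.

Definition uncurry_cV d (K : 'cV[R]_d -> 'cV[R]_d -> R[i]) (z : 'cV[R]_(d + d)) : R[i] :=
  K (usubmx z) (dsubmx z).

Lemma fourier2_uncurry d (K : 'cV[R]_d -> 'cV[R]_d -> R[i]) :
  fourier2 (uncurry_cV K) = uncurry_cV (fun eta => fourier (K eta)).
Proof.
apply/funext => z; rewrite /fourier2 /uncurry_cV /fourier; congr cint.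
by apply/funext => y; rewrite col_mxKu col_mxKd.
Qed.

Lemma rdom_slice d (K : 'cV[R]_d -> 'cV[R]_d -> R[i]) eta : rdom (uncurry_cV K) -> rdom (K eta).
Proof.
move=> /(rdom_coll eta); congr rdom; apply/funext => y.
by rewrite /uncurry_cV col_mxKu col_mxKd.
Qed.

(** [rho] factors, so that integrating out [y] leaves [rho eta]; the character is bounded, which
    makes the estimate uniform in [u]. *)
Lemma fourier_majorant d (K : 'cV[R]_d -> 'cV[R]_d -> R[i]) : rdom (uncurry_cV K) ->
  exists M, forall eta u, norm1c (fourier (K eta) u) <= M * rho eta.
Proof.
move=> dK; have [_ [M KM]] := dK.
(* One factor 2 bounds the character, the other is that of [norm1c_cint_le]. *)
exists (2 * 2 * M * Rintegral (leb d) setT (@rho R d)) => eta u.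
rewrite (_ : 2 * 2 * M * _ * _ = 2 * (2 * M * rho eta) * Rintegral (leb d) setT (@rho R d)); last by ring.
apply: norm1c_cint_le; first exact: (rdom_fourier_arg _ (rdom_slice _ dK)).1.
move=> y; apply: (le_trans (norm1cM _ _)).
rewrite (_ : 2 * M * _ * _ = M * rho (col_mx eta y) * 2); last by rewrite rho_col; ring.
apply: ler_pM; rewrite ?norm1c_ge0 ?norm1c_expi//.
by have := KM (col_mx eta y); rewrite /uncurry_cV col_mxKu col_mxKd.
Qed.

End fourier_derivative.

(** * Rapid decay of Schwartz functions *)

Section schwartz_decay.
Context (R : realType).
Local Notation Re := complex.Re.
Local Notation Im := complex.Im.

Lemma norm_mulmx_le m n (A : 'M[R]_(n, m)) (x : 'cV[R]_m) :
  `|A *m x| <= m%:R * `|A| * `|x|.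
Proof.
rewrite [leLHS]mx_normrE; apply/bigmax_leP; split => [|[i j] _ /=].
  by rewrite !mulr_ge0.
rewrite mxE (le_trans (ler_norm_sum _ _ _))//.
rewrite -mulrA -[m in m%:R](card_ord m) mulr_natl -sumr_const ler_sum// => k _.
rewrite normrM ler_pM//.
  rewrite [leRHS]mx_normrE.
  exact: (le_bigmax _ (fun ij : 'I_n * 'I_m => `|A ij.1 ij.2|) (i, k)).
rewrite [leRHS]mx_normrE.
exact: (le_bigmax _ (fun ij : 'I_m * 'I_1 => `|x ij.1 ij.2|) (k, j)).
Qed.

Lemma expr1D_le (m : R) N : 0 <= m -> (1 + m) ^+ N <= 2 ^+ N * (1 + m ^+ N).
Proof.
move=> m0; have [m1|m1] := leP m 1.
  apply: (@le_trans _ _ (2 ^+ N)).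
    by rewrite lerXn2r ?nnegrE ?addr_ge0//; lra.
  by rewrite ler_peMr ?exprn_ge0// lerDl exprn_ge0.
apply: (@le_trans _ _ ((2 * m) ^+ N)).
  by rewrite lerXn2r ?nnegrE ?addr_ge0 ?mulr_ge0//; lra.
by rewrite exprMn ler_wpM2l ?exprn_ge0// lerDr.
Qed.

(** The sup norm is attained at a coordinate, so powers of single coordinates control |x|^N. The
    parameter [t] carries estimates that must be uniform in a second variable. *)
Lemma rapid_decay (T : Type) n (h : T -> 'cV[R]_n -> R) N :
  (exists M, forall t x, h t x <= M) ->
  (forall i, exists M, forall t (x : 'cV[R]_n), `|x i 0| ^+ N * h t x <= M) ->
  (forall t x, 0 <= h t x) ->
  exists M, forall t (x : 'cV[R]_n), h t x <= M * (1 + `|x|) ^- N.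
Proof.
move=> [M0 hM0] /choice[M hM] h0.
(* The second [M0] is for |x| = 0 with N = 0, where |x|^N = 1 while no coordinate need exist to
   provide some [M i]. *)
exists (2 ^+ N * (M0 + (M0 + \sum_i M i))) => t x.
have M0_ge0 : 0 <= M0 by exact: le_trans (h0 t 0) (hM0 t 0).
have M_ge0 i : 0 <= M i.
  by apply: le_trans (hM i t 0); rewrite mulr_ge0// exprn_ge0.
have x1 : 0 < 1 + `|x| by rewrite ltr_wpDr.
rewrite ler_pdivlMr ?exprn_gt0// mulrC.
apply: (@le_trans _ _ (2 ^+ N * (1 + `|x| ^+ N) * h t x)).
  by rewrite ler_wpM2r// expr1D_le.
rewrite -mulrA ler_wpM2l ?exprn_ge0// mulrDl mul1r lerD//.
have [x0|x0] := eqVneq `|x| 0.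
  rewrite x0 ler_wpDr ?sumr_ge0//.
  by case: N {hM} => [|N]; rewrite ?expr0 ?mul1r// expr0n mul0r.
have [[i j] /= xi] := mx_norm_neq0 x0.
rewrite [`|x|]xi ord1 (le_trans (hM i t x))//.
by rewrite ler_wpDl// (bigD1 i)//= lerDl sumr_ge0.
Qed.

Lemma rschwartz_partial n (u : 'cV[R]_n -> R) i : rschwartz u -> rschwartz (partial i u).
Proof.
have E beta : partials beta (partial i u) = partials (rcons beta i) u.
  by rewrite /partials foldr_rcons.
by move=> [du bu]; split => [beta x|alpha beta]; rewrite E.
Qed.

Lemma rschwartz_differentiable n (u : 'cV[R]_n -> R) x : rschwartz u -> differentiable u x.
Proof. by move=> [/(_ [::])]. Qed.

Lemma rschwartz_measurable n (u : 'cV[R]_n -> R) : rschwartz u ->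
  measurable_fun [set: 'cV[R]_n] (u : _ -> measurableTypeR R).
Proof.
move=> su; apply: continuous_measurable_cV => x.
by apply: differentiable_continuous; exact: rschwartz_differentiable.
Qed.

Lemma rschwartz_decay n (u : 'cV[R]_n -> R) N : rschwartz u ->
  exists2 M, 0 <= M & forall x, `|u x| <= M * (1 + `|x|) ^- N.
Proof.
move=> [_ su].
have [||//|M HM] := @rapid_decay unit n (fun _ x => `|u x|) N.
- have [M HM] := su [::] [::]; exists M => _ x.
  by have := HM x; rewrite big_nil mul1r.
- move=> i; have [M HM] := su (nseq N i) [::]; exists M => _ x.
  have := HM x; rewrite normrM; congr (_ * _ <= _).
  by rewrite big_nseq iter_mulr_1 normrX.
exists M; last by move=> x; exact: (HM tt).
by have := HM tt 0; rewrite normr0 addr0 expr1n invr1 mulr1; exact: le_trans.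
Qed.

(** The difference quotients of the reflected function along a coordinate vector are those of [u]
    along its opposite, and the differential is linear. *)
Lemma is_derive_reflect n (u : 'cV[R]_n -> R) (b y : 'cV[R]_n) i :
  rschwartz u ->
  is_derive y (delta_mx i 0) (fun y => u (b - y)) (- partial i u (b - y)).
Proof.
move=> su; have du := rschwartz_differentiable (b - y) su.
have [df1 df2] : is_derive (b - y) (- delta_mx i 0) u (- partial i u (b - y)).
  split; first exact: diff_derivable.
  by rewrite /partial !deriveE// linearN.
have E : (fun h : R => h^-1 *: (((fun y => u (b - y)) \o shift y) (h *: delta_mx i 0) -
      u (b - y))) =
    (fun h => h^-1 *: ((u \o shift (b - y)) (h *: - delta_mx i 0) - u (b - y))).
  apply/funext => h /=; congr (_ *: (u _ - _)).
  by rewrite scalerN opprD addrCA.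
by split; [rewrite /derivable E|rewrite /derive E].
Qed.

(** * A class of kernels closed under differentiation, and its partial Fourier transforms *)

Section sums_of_products.
Context (d : nat) (B B' : 'M[R]_d).
(* Under this hypothesis (eta, y) |-> (B eta - y, B' eta - y) is invertible, hence
   u (B eta - y) * v (B' eta - y) decays in eta and y jointly. *)
Context (BB' : B - B' = 1%:M).

(** Leibniz' rule in [y], with the sign due to [- y], sends a product to a sum of opposites of such
    products; the three constructors make the class stable under differentiation in [y]. *)
Inductive sprod : ('cV[R]_d -> 'cV[R]_d -> R) -> Prop :=
| sprodM u v : rschwartz u -> rschwartz v ->
    sprod (fun eta y => u (B *m eta - y) * v (B' *m eta - y))
| sprodD K K' : sprod K -> sprod K' -> sprod (fun eta y => K eta y + K' eta y)
| sprodN K : sprod K -> sprod (fun eta y => - K eta y).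

Lemma sprod_derive K i : sprod K -> exists2 K', sprod K' &
  forall eta y, is_derive y (delta_mx i 0) (K eta) (K' eta y).
Proof.
elim=> {K} [u v su sv|K1 K2 _ [K1' s1 d1] _ [K2' s2 d2]|K1 _ [K1' s1 d1]].
- have su' := rschwartz_partial i su; have sv' := rschwartz_partial i sv.
  exists (fun eta y => - (partial i u (B *m eta - y) * v (B' *m eta - y)) +
                     - (u (B *m eta - y) * partial i v (B' *m eta - y))).
    by apply: sprodD; apply: sprodN; exact: sprodM.
  move=> eta y.
  have := is_deriveM (is_derive_reflect (B *m eta) y i su)
                     (is_derive_reflect (B' *m eta) y i sv).
  congr is_derive; rewrite /= [_ *: _]mulrN [X in _ + X]mulrN addrC.
  by congr (- _ - _); rewrite mulrC.
- exists (fun eta y => K1' eta y + K2' eta y); first exact: sprodD.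
  by move=> eta y; exact: is_deriveD.
- exists (fun eta y => - K1' eta y); first exact: sprodN.
  by move=> eta y; exact: is_deriveN.
Qed.

Lemma sprod_measurable K : sprod K -> measurable_fun [set: 'cV[R]_(d + d)]
  ((fun z => K (usubmx z) (dsubmx z)) : _ -> measurableTypeR R).
Proof.
elim=> {K} [u v su sv|K1 K2 _ s1 _ s2|K1 _ s1].
- have H (C : 'M[R]_d) w : rschwartz w -> measurable_fun [set: 'cV[R]_(d + d)]
      ((fun z => w (C *m usubmx z - dsubmx z)) : _ -> measurableTypeR R).
    move=> sw; have := measurableT_comp (rschwartz_measurable sw)
      (measurable_mulmx (row_mx C (- 1%:M))).
    congr measurable_fun; apply/funext => z /=.
    by rewrite -[z in LHS]vsubmxK mul_row_col mulNmx mul1mx.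
  by apply: measurable_funM; exact: H.
- exact: measurable_funD.
- exact: measurableT_comp.
Qed.

(** With a = B eta - y and b = B' eta - y one has eta = a - b and y = B eta - a, so 1 + |eta| and 1
    + |y| are both at most a constant times (1 + |a|) (1 + |b|). Decay in a and b thus becomes decay
    in eta and y. *)
Lemma sprod_bound K : sprod K ->
  exists2 M, 0 <= M & forall eta y, `|K eta y| <= M * (rho eta * rho y).
Proof.
elim=> {K} [u v su sv|K1 K2 _ [M1 M10 H1] _ [M2 M20 H2]|K1 _ [M1 M10 H1]].
(* Half of the order is spent on [eta] and half on [y]; each half is the order 2d of [rho_lower]. *)
- have [M M0 uM] := rschwartz_decay (d.*2 + d.*2) su.
  have [M' M'0 vM'] := rschwartz_decay (d.*2 + d.*2) sv.
  (* From |B eta| <= d |B| |eta| in the sup norm. *)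
  pose c := 1 + d%:R * `|B|.
  have c1 : 1 <= c by rewrite lerDl mulr_ge0.
  exists (M * M' * c ^+ d.*2).
    by rewrite !mulr_ge0// exprn_ge0// (le_trans _ c1).
  move=> eta y; set a := B *m eta - y; set b := B' *m eta - y.
  have p0 (w : 'cV[R]_d) : 0 < 1 + `|w| by rewrite ltr_wpDr.
  rewrite normrM (le_trans (ler_pM _ _ (uM a) (vM' b)))//.
  rewrite mulrACA -[leRHS]mulrA ler_wpM2l ?mulr_ge0//.
  apply: (@le_trans _ _ (c ^+ d.*2 * ((1 + `|eta|) ^- d.*2 * (1 + `|y|) ^- d.*2))); last first.
    rewrite ler_wpM2l ?exprn_ge0 ?(le_trans _ c1)//.
    apply: ler_pM; [| |exact: rho_lower|exact: rho_lower].
      by rewrite invr_ge0 exprn_ge0// ltW.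
    by rewrite invr_ge0 exprn_ge0// ltW.
  have etaE : `|eta| <= `|a| + `|b|.
    rewrite (_ : eta = a - b); first exact: ler_normB.
    by rewrite /a /b opprB addrA subrK -mulmxBl BB' mul1mx.
  have yE : `|y| <= d%:R * `|B| * `|eta| + `|a|.
    rewrite (_ : y = B *m eta - a); last by rewrite /a subKr.
    by rewrite (le_trans (ler_normB _ _))// lerD2r norm_mulmx_le.
  have e1 : 1 + `|eta| <= (1 + `|a|) * (1 + `|b|).
    have : 0 <= `|a| * `|b| by rewrite mulr_ge0.
    by lra.
  have e2 : 1 + `|y| <= c * ((1 + `|a|) * (1 + `|b|)).
    apply: (@le_trans _ _ (1 + (d%:R * `|B| * (`|a| + `|b|) + `|a|))).
      rewrite lerD2l (le_trans yE)// lerD2r ler_wpM2l// mulr_ge0//.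
    have : 0 <= `|a| * `|b| by rewrite mulr_ge0.
    have : 0 <= d%:R * `|B| by rewrite mulr_ge0.
    have := normr_ge0 b; rewrite /c; nra.
  have p1 : 0 < (1 + `|a|) * (1 + `|b|) by rewrite mulr_gt0.
  rewrite -invfM -exprMn exprD invfM [leRHS]mulrCA; apply: ler_pM.
  - by rewrite invr_ge0 exprn_ge0// ltW.
  - by rewrite invr_ge0 exprn_ge0// ltW.
  - rewrite lef_pV2 ?posrE ?exprn_gt0 ?p0//.
    by rewrite lerXn2r ?nnegrE ?(ltW p1) ?(ltW (p0 _)).
  - rewrite -!exprVn -exprMn lerXn2r ?nnegrE ?mulr_ge0 ?invr_ge0 ?(ltW (p0 _)) ?(ltW p1) ?(le_trans _ c1)//.
    by rewrite ler_pdivlMr ?p0// mulrC ler_pdivrMr.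
- exists (M1 + M2); first exact: addr_ge0.
  move=> eta y; rewrite (le_trans (ler_normD _ _))// mulrDl lerD//.
- by exists M1 => // eta y; rewrite normrN.
Qed.

Definition csprod (K : 'cV[R]_d -> 'cV[R]_d -> R[i]) : Prop :=
  sprod (fun eta y => Re (K eta y)) /\ sprod (fun eta y => Im (K eta y)).

Lemma csprod_rdom K : csprod K -> rdom (uncurry_cV K).
Proof.
move=> [sR sI]; split.
  by split; [exact: (sprod_measurable sR)|exact: (sprod_measurable sI)].
have [M M0 HM] := sprod_bound sR; have [M' M'0 HM'] := sprod_bound sI.
exists (M + M') => z; rewrite -[z in rho z]vsubmxK rho_col mulrDl.
by apply: lerD; [exact: HM|exact: HM'].
Qed.

Lemma csprod_fourier K i : csprod K -> exists2 K', csprod K' &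
  forall eta u, fourier (K' eta) u = (0 +i* (2 * pi * u i 0))%C * fourier (K eta) u.
Proof.
move=> sK; have [sR sI] := sK.
have [KR sKR dR] := sprod_derive i sR; have [KI sKI dI] := sprod_derive i sI.
have sK' : csprod (fun eta y => (KR eta y +i* KI eta y)%C) by [].
exists (fun eta y => (KR eta y +i* KI eta y)%C) => // eta u.
have slice K0 : csprod K0 -> rdom (K0 eta) by move=> /csprod_rdom/rdom_slice.
by apply: fourier_derive => //; [exact: slice|exact: (slice _ sK')].
Qed.

Lemma norm1c_imM (t : R) (w : R[i]) : norm1c ((0 +i* t)%C * w) = `|t| * norm1c w.
Proof.
by rewrite /norm1c !ReImE /= !mul0r sub0r add0r normrN !normrM mulrDr addrC.
Qed.

Lemma csprod_fourier_expr K i N : csprod K -> exists2 K', csprod K' &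
  forall eta u, norm1c (fourier (K' eta) u) =
    `|2 * pi * u i 0| ^+ N * norm1c (fourier (K eta) u).
Proof.
move=> sK; elim: N => [|N [K1 s1 H1]].
  by exists K => // eta u; rewrite expr0 mul1r.
have [K2 s2 H2] := csprod_fourier i s1; exists K2 => // eta u.
by rewrite H2 norm1c_imM H1 exprS mulrA.
Qed.

(** Each derivative in [y] stays in the class and multiplies the transform by 2 pi i u_i, so
    |u_i|^(2d) times the transform is still bounded by a multiple of [rho eta], uniformly in [u].
    After division by [rho eta], [rapid_decay] applies with [eta] as parameter. *)
Lemma csprod_fourier_rdom K : csprod K -> rdom (fourier2 (uncurry_cV K)).
Proof.
move=> sK; have dK := csprod_rdom sK; split; first exact: cmeas_fourier2 dK.1.
rewrite fourier2_uncurry.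
have [M0 HM0] := fourier_majorant dK.
have [||eta u|M HM] := @rapid_decay 'cV[R]_d d
  (fun eta u => norm1c (fourier (K eta) u) / rho eta) d.*2.
- by exists M0 => eta u; rewrite ler_pdivrMr ?rho_gt0.
- move=> i; have [K' sK' HK'] := csprod_fourier_expr i d.*2 sK.
  have [M1 HM1] := fourier_majorant (csprod_rdom sK').
  exists M1 => eta u; rewrite mulrA ler_pdivrMr ?rho_gt0//.
  rewrite (le_trans _ (HM1 eta u))// HK' ler_wpM2r ?norm1c_ge0//.
  (* Since 2 pi >= 1, |u_i| <= |2 pi u_i|. *)
  rewrite lerXn2r ?nnegrE// normrM ler_peMl//.
  have := @pi_ge2 R; rewrite gtr0_norm; have := pi_gt0 R; lra.
- by rewrite divr_ge0 ?norm1c_ge0 ?rho_ge0.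
exists M => z; rewrite -[z in rho z]vsubmxK rho_col.
have := HM (usubmx z) (dsubmx z); rewrite ler_pdivrMr ?rho_gt0// => /le_trans; apply.
have M_ge0 : 0 <= M.
  have := HM 0 0; rewrite normr0 addr0 expr1n invr1 mulr1; apply: le_trans.
  by rewrite divr_ge0 ?norm1c_ge0 ?rho_ge0.
by rewrite -mulrA ler_wpM2l// [leRHS]mulrC ler_wpM2r ?rho_ge0 ?rho_lower.
Qed.

End sums_of_products.
End schwartz_decay.

(** * Symplectic matrices and metaplectic operators *)

Section symplectic_matrices.
Context (R : realType).

Lemma trmxN m n (A : 'M[R]_(m, n)) : (- A)^T = - A^T.
Proof. exact: linearN. Qed.

Lemma trmxB m n (A B : 'M[R]_(m, n)) : (A - B)^T = A^T - B^T.
Proof. exact: linearB. Qed.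

Definition bmxE := (mulmx_block, add_block_mx, opp_block_mx, mul0mx, mulmx0,
  mul1mx, mulmx1, mulNmx, mulmxN, add0r, addr0, oppr0, @opprK, block_mx0).

Lemma symplecticM n (A B : 'M[R]_(n + n)) :
  symplectic A -> symplectic B -> symplectic (A *m B).
Proof.
rewrite /symplectic => HA HB.
by rewrite trmx_mul -!mulmxA (mulmxA A^T) (mulmxA (A^T *m _)) HA mulmxA.
Qed.

Lemma symplectic_J n : symplectic (symp_J R n).
Proof.
rewrite /symplectic /symp_J tr_block_mx !mulmx_block !(trmx0, trmx1, trmxN).
by rewrite !bmxE.
Qed.

Lemma symplectic_V n (C : 'M[R]_n) : C^T = C -> symplectic (symp_V C).
Proof.
move=> CT; rewrite /symplectic /symp_J /symp_V tr_block_mx !mulmx_block !trmx0 trmx1 CT.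
by rewrite !bmxE addNr.
Qed.

Lemma symplectic_D n (L : 'M[R]_n) : L \in unitmx -> symplectic (symp_D L).
Proof.
move=> uL; rewrite /symplectic /symp_J /symp_D tr_block_mx !mulmx_block !trmx0 trmxK.
rewrite !bmxE.
by rewrite -trmx_mul !mulmxV// trmx1.
Qed.

Lemma symplectic_FT2 d : symplectic (symp_FT2 R d).
Proof.
rewrite /symplectic /symp_J /symp_FT2 !tr_block_mx !(trmx0, trmx1, trmxN).
by rewrite !bmxE (scalar_mx_block d d 1) !bmxE.
Qed.

(** * The covariant matrix and its factorizations *)

Section covariant.
Context (d : nat) (A11 A13 A21 : 'M[R]_d).

Definition covL : 'M[R]_(d + d) := block_mx 1%:M (1%:M - A11) 1%:M (- A11).
Definition covC : 'M[R]_(d + d) := block_mx A13 0 0 (- A21).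
Definition covM : 'M[R]_(d + d) := block_mx (1%:M - A11) (- 1%:M) (- A11) (- 1%:M).
Definition swap_mx : 'M[R]_(d + d) := block_mx 0 1%:M 1%:M 0.
Definition reflect_mx : 'M[R]_(d + d) := block_mx 1%:M 0 0 (- 1%:M).

Lemma mulmx1_invmx n (L L' : 'M[R]_n) : L *m L' = 1%:M ->
  (L \in unitmx) * (invmx L = L').
Proof.
move=> LL'; have [uL _] := mulmx1_unit LL'; split => //.
by rewrite -[LHS]mulmx1 -LL' mulKmx.
Qed.

(** The inverse solves (p, q) = L (y, eta): eta = p - q and y = A11 p + (I - A11) q. *)
Lemma covLV : covL *m block_mx A11 (1%:M - A11) 1%:M (- 1%:M) = 1%:M.
Proof.
by rewrite /covL !bmxE !subrr subrKC subrK -scalar_mx_block.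
Qed.

Lemma covMV : covM *m block_mx 1%:M (- 1%:M) (- A11) (- (1%:M - A11)) = 1%:M.
Proof.
by rewrite /covM !bmxE !addNr subrKC subrK -scalar_mx_block.
Qed.

Lemma swap_mxV : swap_mx *m swap_mx = 1%:M.
Proof. by rewrite /swap_mx !bmxE -scalar_mx_block. Qed.

Lemma reflect_mxV : reflect_mx *m reflect_mx = 1%:M.
Proof. by rewrite /reflect_mx !bmxE -scalar_mx_block. Qed.

Lemma normr_det_involution n (P : 'M[R]_n) : P *m P = 1%:M -> `|\det P| = 1.
Proof.
move=> PP; apply/eqP; rewrite -(@eqrXn2 _ 2)//.
by rewrite expr1n expr2 -normrM -det_mulmx PP det1 normr1.
Qed.

(** Subtracting the second block row from the first makes the matrix triangular. As a result the
    dilation by [covM] carries no constant. *)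
Lemma normr_det_covM : `|\det covM| = 1.
Proof.
have -> : covM = block_mx 1%:M 1%:M 0 1%:M *m block_mx 1%:M 0 (- A11) (- 1%:M).
  by rewrite !bmxE.
by rewrite det_mulmx det_ublock det_lblock !det1 !mul1r -scaleN1r detZ det1 mulr1 normrX normrN1 expr1n.
Qed.

Context (A13_sym : A13^T = A13) (A21_sym : A21^T = A21).

Lemma covariant_decomposition :
  covariant_mx A11 A13 A21 = (symp_V covC)^T *m symp_FT2 R d *m symp_D covL.
Proof.
rewrite /symp_D (mulmx1_invmx covLV).2 /symp_V /symp_FT2 /covC /covL /covariant_mx.
rewrite !tr_block_mx !(trmx0, trmx1, trmxN, trmxB, A13_sym, A21_sym).
by rewrite !bmxE.
Qed.

Lemma covariant_factorization :
  covariant_mx A11 A13 A21 =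
  symp_J R (d + d) *m (symp_V (- covC) *m (symp_D swap_mx *m
    (symp_FT2 R d *m symp_D covM))).
Proof.
rewrite /symp_D (mulmx1_invmx covMV).2 (mulmx1_invmx swap_mxV).2.
rewrite /symp_V /symp_FT2 /covC /covM /swap_mx /covariant_mx /symp_J.
rewrite !tr_block_mx !(trmx0, trmx1, trmxN, trmxB, A13_sym, A21_sym).
by rewrite !bmxE.
Qed.

Lemma FT2_sqr : symp_FT2 R d *m symp_FT2 R d = symp_D reflect_mx.
Proof.
rewrite /symp_D (mulmx1_invmx reflect_mxV).2 /reflect_mx /symp_FT2.
rewrite tr_block_mx !(trmx0, trmx1, trmxN).
by rewrite !bmxE.
Qed.
End covariant.
End symplectic_matrices.

(** * Composition of metaplectic operators up to a phase, and the multiplication formula *)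

Section metaplectic_chain.
Context (R : realType).
Local Notation Re := complex.Re.
Local Notation Im := complex.Im.

Lemma conjcM (z w : R[i]) : ((z * w)^*)%C = (z^*)%C * (w^*)%C.
Proof. by apply: complex_ext; rewrite !ReImE; ring. Qed.

Lemma rdom0 n : rdom (fun _ : 'cV[R]_n => 0).
Proof.
split; first exact: cmeas_cst.
by exists 0 => x; rewrite /norm1c !normr0 addr0 mul0r.
Qed.

(** Linearity at two zero functions gives U 0 = U 0 + U 0, so U 0 vanishes almost everywhere;
    homogeneity is then linearity with second function 0. *)
Lemma unitary_scale n (U : operator R n) (a : R[i]) (F : 'cV[R]_n -> R[i]) :
  unitary_L2 U -> in_L2 F ->
  {ae leb n, forall t, U (fun s => a * F s) t = a * U F t}.
Proof.
move=> uU F2; pose z : 'cV[R]_n -> R[i] := fun _ => 0.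
have z2 : in_L2 z by exact/rdom_in_L2/rdom0.
have := unitary_linear uU 1 z2 z2.
rewrite (_ : (fun s => 1 * z s + z s) = z); last first.
  by apply/funext => s; rewrite mul1r addr0.
have := unitary_linear uU a F2 z2.
rewrite (_ : (fun s => a * F s + z s) = (fun s => a * F s)); last first.
  by apply/funext => s; rewrite addr0.
apply: filterS2 => t -> /eqP.
rewrite mul1r addrC -subr_eq subrr => /eqP <-.
by rewrite addr0.
Qed.

(** Three phases multiply: those of the product rule, of [V] and of [U]. The phase of [V] appears
    inside [mu X], which respects almost everywhere equality on L^2 only; [unitary_ae] and
    [unitary_scale] bring it out. None of the three depends on [F]. *)
Lemma eq_phase_comp d (mu : 'M[R]_((d + d) + (d + d)) -> operator R (d + d))
    (X Y : 'M[R]_((d + d) + (d + d))) (dom dom' : ('cV[R]_(d + d) -> R[i]) -> Prop)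
    (U V : operator R (d + d)) :
  metaplectic mu -> symplectic X -> symplectic Y ->
  (forall F, dom F -> [/\ in_L2 F, rdom (V F) & dom' (V F)]) ->
  eq_phase_on dom (mu Y) V -> eq_phase_on dom' (mu X) U ->
  eq_phase_on dom (mu (X *m Y)) (U \o V).
Proof.
move=> mmu sX sY domP [c2 c2n VE] [c3 c3n UE].
have [c1 c1n XYE] := metaplectic_mul mmu sX sY.
have uX := metaplectic_unitary mmu sX; have uY := metaplectic_unitary mmu sY.
exists (c1 * c2 * c3); first by rewrite !normrM c1n c2n c3n !mulr1.
move=> F dF; have [F2 rV dV] := domP _ dF.
have V2 := rdom_in_L2 rV; have cV2 := rdom_in_L2 (rdomZ c2 rV).
have H1 := XYE _ F2.
have H2 := unitary_ae uX (unitary_in_L2 uY F2) cV2 (VE _ dF).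
have H3 := unitary_scale c2 uX V2.
have H4 := UE _ dV.
have H12 : {ae leb (d + d), forall t, mu (X *m Y) F t = c1 * mu X (fun s => c2 * V F s) t}.
  by apply: filterS2 H1 H2 => t -> /= ->.
have H34 : {ae leb (d + d), forall t, mu X (fun s => c2 * V F s) t = c2 * (c3 * U (V F) t)}.
  by apply: filterS2 H3 H4 => t -> ->.
by apply: filterS2 H12 H34 => t -> ->; rewrite !mulrA.
Qed.

Lemma eq_phase_sub n (dom dom' : ('cV[R]_n -> R[i]) -> Prop) (U V V' : operator R n) :
  (forall F, dom' F -> dom F) -> (forall F, dom' F -> V' F = V F) ->
  eq_phase_on dom U V -> eq_phase_on dom' U V'.
Proof.
move=> sub VV [c cn UV]; exists c => // F dF.
by rewrite VV//; exact/UV/sub.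
Qed.

Lemma metaplectic_D1 d (mu : 'M[R]_((d + d) + (d + d)) -> operator R (d + d)) L :
  metaplectic mu -> L \in unitmx -> `|\det L| = 1 ->
  eq_phase_on (@in_L2 R _) (mu (symp_D L)) (fun F t => F (L *m t)).
Proof.
move=> mmu uL dL; apply: eq_phase_sub (metaplectic_D mmu uL) => // F _.
by apply/funext => t; rewrite dL sqrtr1 mul1r.
Qed.

Definition nonneg_c (z : R[i]) := 0 <= Re z /\ Im z = 0.

Lemma cint_nonneg n (F : 'cV[R]_n -> R[i]) :
  (forall x, nonneg_c (F x)) -> nonneg_c (cint F).
Proof.
move=> F0; split => /=.
  by apply: Rintegral_ge0 => x _; exact: (F0 x).1.
under eq_Rintegral do rewrite (F0 _).2.
by rewrite /Rintegral integral0.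
Qed.

Lemma mulcJ_nonneg (z : R[i]) : nonneg_c (z * (z^*)%C).
Proof.
split; rewrite !ReImE; last by ring.
by rewrite mulrN opprK -!expr2 addr_ge0 ?sqr_ge0.
Qed.

Lemma mulcJ_eq0 (z : R[i]) : Re (z * (z^*)%C) = 0 -> z = 0.
Proof.
move=> /eqP; rewrite !ReImE mulrN opprK -!expr2.
rewrite paddr_eq0 ?sqr_ge0// !sqrf_eq0 => /andP[/eqP Rz /eqP Iz].
exact: complex_ext.
Qed.

(** A nonzero [a] forces [c] to be real and nonnegative, and its modulus is 1. *)
Lemma nonneg_phase (c a : R[i]) : `|c| = 1 -> nonneg_c a -> nonneg_c (c * a) ->
  a = 0 \/ c = 1.
Proof.
move=> c1 [a0 Ia] [ca0 Ica].
have [Ra|Ra] := eqVneq (Re a) 0; first by left; exact: complex_ext.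
right; move: ca0 Ica; rewrite !ReImE Ia !mulr0 subr0 add0r => ca0 /eqP.
rewrite mulf_eq0 (negbTE Ra) orbF => /eqP Ic.
have Rapos : 0 < Re a by rewrite lt_neqAle eq_sym Ra.
have c0 : 0 <= Re c by rewrite -(pmulr_lge0 _ Rapos).
move: c1; rewrite normc_def Ic expr0n addr0 sqrtr_sqr ger0_norm// => -[Rc].
by apply: complex_ext.
Qed.

Lemma rdom_reflect n (k : 'cV[R]_n -> R[i]) : rdom k -> rdom (fun x => k (- x)).
Proof.
move=> [mk [M kM]]; split.
  have := cmeas_comp mk (measurable_affine_cV (-1) 0); congr cmeas.
  by apply/funext => x /=; rewrite scaleN1r addr0.
exists M => x; rewrite (le_trans (kM _))// le_eqVlt; apply/orP; left.
by apply/eqP; congr (_ * _); apply: eq_bigr => i _; rewrite mxE sqrrN.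
Qed.

(** The multiplication formula, which moves the Fourier transform from one factor of an integral to
    the other, applied to F k and to the conjugate of k(-x), whose transform is the conjugate of F
    k. *)
Lemma cint_fourier_fourier n (k : 'cV[R]_n -> R[i]) :
  rdom k -> rdom (fourier k) ->
  cint (fun x => fourier (fourier k) x * ((k (- x))^*)%C) =
  cint (fun u => fourier k u * ((fourier k u)^*)%C).
Proof.
move=> dk dFk.
pose Q (w : 'cV[R]_(n + n)) : R[i] := fourier k (dsubmx w) *
  ((k (- usubmx w))^*)%C * expi (- (2 * pi * dot (usubmx w) (dsubmx w))).
have dkr := rdomJ (rdom_reflect dk).
have dQ : rdom Q.
  apply: rdomM_expi.
    apply: (measurableT_comp (@oppr_measurable R setT)).
    apply: measurable_funM => //; apply: measurable_dot.
      exact: measurable_usubmx.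
    exact: measurable_dsubmx.
  split.
    apply: cmeasM.
      exact: (cmeas_comp dFk.1 (@measurable_dsubmx R n n)).
    exact: (cmeas_comp dkr.1 (@measurable_usubmx R n n)).
  have [_ [M HM]] := dFk; have [_ [M' HM']] := dkr.
  exists (M * M') => w; rewrite (le_trans (norm1cM _ _))//.
  rewrite -[w in rho w]vsubmxK rho_col [rho _ * _]mulrC mulrACA.
  by apply: ler_pM; rewrite ?norm1c_ge0.
have iQ := rdom_in_L1 dQ.
transitivity (cint Q).
  rewrite (cint_col iQ); congr cint; apply/funext => x.
  rewrite -cintZr; last exact/rdom_in_L1/rdom_fourier_arg.
  congr cint; apply/funext => u; rewrite /Q col_mxKu col_mxKd mulrAC.
  by [].
rewrite (cint_col_sym iQ); congr cint; apply/funext => u.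
rewrite -[in RHS]cintJ; last exact/rdom_in_L1/rdom_fourier_arg.
rewrite -cintZ; last exact/rdom_in_L1/rdomJ/rdom_fourier_arg.
pose G x := fourier k u * ((k x * expi (- (2 * pi * dot u x)))^*)%C.
have mG : cmeas G by have [] := rdomZ (fourier k u) (rdomJ (rdom_fourier_arg u dk)).
(* The change x -> -x matches the reflection of [k] with the conjugated character. *)
rewrite -[RHS](cint_affine (a := -1) 0 (or_intror erefl) mG).
congr cint; apply/funext => x; rewrite /Q /G col_mxKu col_mxKd scaleN1r addr0.
rewrite conjcM expiJ -mulrA; congr (_ * (_ * expi _)).
by rewrite dotNr dotC; ring.
Qed.

End metaplectic_chain.

(** * Fourier inversion almost everywhere *)

Section covariant_wigner.
Context (R : realType) (d : nat).
Local Notation Re := complex.Re.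
Local Notation Im := complex.Im.
Local Notation E := (d + d)%N.

Lemma reflect_mxE (z : 'cV[R]_E) :
  reflect_mx R d *m z = col_mx (usubmx z) (- dsubmx z).
Proof.
by rewrite -[z in LHS]vsubmxK /reflect_mx mul_block_col !bmxE.
Qed.

(* The phase is determined by pairing with the reflection G' of K. *)
Lemma ae_fourier_inversion (mu : 'M[R]_(E + E) -> operator R E)
    (K : 'cV[R]_d -> 'cV[R]_d -> R[i]) :
  metaplectic mu -> rdom (uncurry_cV K) -> rdom (fourier2 (uncurry_cV K)) ->
  {ae leb E, forall w, fourier (fourier (K (usubmx w))) (dsubmx w) =
                       K (usubmx w) (- dsubmx w)}.
Proof.
move=> mmu dK dFK.
(* [metaplectic_FT2] is applied twice, so the function and its partial transform must both lie in
   L^1 and L^2. *)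
pose dom (F : 'cV[R]_E -> R[i]) := rdom F /\ rdom (fourier2 F).
have sFT := symplectic_FT2 R d.
have uS := (mulmx1_invmx (reflect_mxV R d)).1.
have [c1 c1n H1] : eq_phase_on dom (mu (symp_D (reflect_mx R d))) (@fourier2 R d \o @fourier2 R d).
  rewrite -FT2_sqr; apply: (eq_phase_comp (dom' := fun F => in_L1 F /\ in_L2 F) mmu sFT sFT).
  - move=> F [rF rFF]; split; [exact: rdom_in_L2|exact: rFF|].
    by split; [exact: rdom_in_L1|exact: rdom_in_L2].
  - apply: eq_phase_sub (metaplectic_FT2 mmu) => // F [rF _].
    by split; [exact: rdom_in_L1|exact: rdom_in_L2].
  - exact: metaplectic_FT2.
have [c2 c2n H2] := metaplectic_D1 mmu uS (normr_det_involution (reflect_mxV R d)).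
pose G := uncurry_cV K.
pose G' w := G (reflect_mx R d *m w).
have G'E w : G' w = K (usubmx w) (- dsubmx w).
  by rewrite /G' reflect_mxE /G /uncurry_cV col_mxKu col_mxKd.
have dG' : rdom G'.
  have [mG [M GM]] := dK; split; first exact: (cmeas_comp mG (measurable_mulmx _)).
  exists M => w; rewrite (le_trans (GM _))// le_eqVlt; apply/orP; left; apply/eqP.
  congr (_ * _); rewrite reflect_mxE -[w in RHS]vsubmxK !rho_col; congr (_ * _).
  by apply: eq_bigr => i _; rewrite !mxE sqrrN.
have c1_neq0 : c1 != 0 by rewrite -normr_eq0 c1n oner_eq0.
(* The same operator, that of [symp_D] at [reflect_mx], is known in two ways, with phases [c1] and
   [c2]. *)
pose c := c1^-1 * c2.
have cn : `|c| = 1 by rewrite normrM normfV c1n c2n invr1 mulr1.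
have FFE : {ae leb E, forall w, fourier2 (fourier2 G) w = c * G' w}.
  have := H1 G (conj dK dFK); have := H2 G (rdom_in_L2 dK).
  apply: filterS2 => w -> /= Hw; rewrite /c -mulrA [in RHS]/G' Hw mulKf//.
have FFK : fourier2 (fourier2 G) = uncurry_cV (fun eta => fourier (fourier (K eta))).
  by rewrite /G !fourier2_uncurry.
pose a := cint (fun w => G' w * ((G' w)^*)%C).
have a_ge0 : nonneg_c a by apply: cint_nonneg => w; exact: mulcJ_nonneg.
(* The double transform is only known to be bounded here; in its product with the conjugate of [G'],
   the majorant comes from [G']. *)
have [b FFb] : exists b, forall w, norm1c (fourier2 (fourier2 G) w) <= b.
  have := @fourier_majorant _ _ (fun eta => fourier (K eta)).
  rewrite -(fourier2_uncurry K) => /(_ dFK)[M HM]; exists M => w.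
  rewrite FFK; apply: (le_trans (HM _ _)); apply: ler_piMr; last exact: rho_le1.
  have := HM 0 0; rewrite -(pmulr_lge0 M (rho_gt0 (0 : 'cV[R]_d))).
  exact: le_trans (norm1c_ge0 _).
have mFF : cmeas (fourier2 (fourier2 G)) by apply/cmeas_fourier2/cmeas_fourier2; exact: dK.1.
have dP : rdom (fun w => fourier2 (fourier2 G) w * ((G' w)^*)%C).
  have := rdomMb (rdomJ dG') mFF FFb; congr rdom; apply/funext => w.
  by rewrite mulrC.
have dGG : rdom (fun w => G' w * ((G' w)^*)%C).
  have [_ [M GM]] := rdomJ dG'.
  apply: (rdomMb (b := M) dG'); first exact: (rdomJ dG').1.
  move=> w; apply: (le_trans (GM w)).
  apply: ler_piMr; [exact: majorant_ge0 GM|exact: rho_le1].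
have ca_ge0 : nonneg_c (c * a).
  rewrite /a -cintZ; last exact: rdom_in_L1.
  rewrite -(@ae_eq_cint _ _ (fun w => fourier2 (fourier2 G) w * ((G' w)^*)%C)).
  - rewrite cint_col; last exact: rdom_in_L1.
    (* For each [eta] the inner integral is the squared L^2 norm of the transform of [K eta]. *)
    apply: cint_nonneg => eta.
    rewrite (_ : (fun _ => _) = fun x => fourier (fourier (K eta)) x * ((K eta (- x))^*)%C); last first.
      by apply/funext => x; rewrite FFK G'E /uncurry_cV col_mxKu col_mxKd.
    rewrite cint_fourier_fourier; last 2 first.
    + exact: (rdom_slice _ dK).
    + by move: dFK; rewrite fourier2_uncurry => /(rdom_slice eta).
    by apply: cint_nonneg => u; exact: mulcJ_nonneg.
  - exact: dP.1.
  - by have [] := rdomZ c dGG.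
  - by apply: filterS FFE => w ->; rewrite mulrA.
(* If the norm of [G'] vanishes the phase stays undetermined, but then both sides are 0 almost
   everywhere. *)
have [a0|c_eq1] := nonneg_phase cn a_ge0 ca_ge0.
- have G'0 : {ae leb E, forall w, G' w = 0}.
    have iGG := (rdom_in_L1 dGG).1.
    have int0 : (\int[leb E]_w `|(Re (G' w * ((G' w)^*)%C))%:E| = 0)%E.
      transitivity (\int[leb E]_w (Re (G' w * ((G' w)^*)%C))%:E)%E.
        apply: eq_integral => w _; apply: gee0_abs.
        rewrite lee_fin; exact: (mulcJ_nonneg (G' w)).1.
      apply: (etrans (esym (fineK (integrable_fin_num measurableT iGG)))).
      have Ra : Re a = 0 by rewrite a0.
      by congr EFin; rewrite -[LHS]/(Re a).
    have := (ae_eq_integral_abs _ measurableT (measurable_int _ iGG)).1 int0.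
    by apply: filterS => w /(_ Logic.I) [] /mulcJ_eq0.
  apply: filterS2 FFE G'0 => w; rewrite FFK G'E => + G'w.
  by rewrite G'w mulr0.
- by apply: filterS FFE => w; rewrite FFK G'E c_eq1 mul1r.
Qed.

(** * The covariant operator on Schwartz tensors *)

Context (A11 A13 A21 : 'M[R]_d).
Local Notation B := (1%:M - A11).
Local Notation B' := (- A11).
Implicit Types f g : 'cV[R]_d -> R[i].

Lemma BB' : B - B' = 1%:M.
Proof. by rewrite opprK subrK. Qed.

(** The sign of [y] lets the forward transform [fourier2] compute the inverse transform of y -> (f
    (x) conj g)(L (y, eta)). *)
Definition covK f g (eta y : 'cV[R]_d) : R[i] :=
  f (B *m eta - y) * ((g (B' *m eta - y))^*)%C.

Lemma csprod_covK f g : schwartz f -> schwartz g -> csprod B B' (covK f g).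
Proof.
move=> [f1 f2] [g1 g2]; split.
- rewrite (_ : (fun _ _ => _) = fun eta y =>
      Re (f (B *m eta - y)) * Re (g (B' *m eta - y)) +
      Im (f (B *m eta - y)) * Im (g (B' *m eta - y))).
    by apply: sprodD;
      [exact: (sprodM B B' f1 g1)|exact: (sprodM B B' f2 g2)].
  by apply/funext => eta; apply/funext => y; rewrite /covK !ReImE mulrN opprK.
- rewrite (_ : (fun _ _ => _) = fun eta y =>
      - (Re (f (B *m eta - y)) * Im (g (B' *m eta - y))) +
      Im (f (B *m eta - y)) * Re (g (B' *m eta - y))).
    by apply: sprodD; [apply: sprodN; exact: (sprodM B B' f1 g2)|exact: (sprodM B B' f2 g1)].
  by apply/funext => eta; apply/funext => y; rewrite /covK !ReImE mulrN.
Qed.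

Lemma tensor_covM f g (z : 'cV[R]_E) :
  tensor f g (covM A11 *m z) = uncurry_cV (covK f g) z.
Proof.
rewrite -[z in LHS]vsubmxK /covM mul_block_col /tensor col_mxKu col_mxKd.
by rewrite /uncurry_cV /covK !mulNmx mul1mx.
Qed.

Lemma tensor_covL f g (x y eta : 'cV[R]_d) :
  tensor f g (covL A11 *m col_mx (x - y) eta) = covK f g eta (y - x).
Proof.
rewrite /covL mul_block_col /tensor col_mxKu col_mxKd /covK !mul1mx.
by rewrite !opprB ![_ + (x - y)]addrC.
Qed.

Lemma schwartz_rdom n (f : 'cV[R]_n -> R[i]) : schwartz f -> rdom f.
Proof.
move=> [f1 f2]; split.
  by split; exact: rschwartz_measurable.
have [M M0 fM] := rschwartz_decay n.*2 f1; have [M' M'0 fM'] := rschwartz_decay n.*2 f2.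
exists (M + M') => x; rewrite mulrDl lerD//.
  by rewrite (le_trans (fM x))// ler_wpM2l// rho_lower.
by rewrite (le_trans (fM' x))// ler_wpM2l// rho_lower.
Qed.

Lemma rdom_tensor f g : schwartz f -> schwartz g -> rdom (tensor f g).
Proof.
move=> /schwartz_rdom[mf [M fM]] /schwartz_rdom/rdomJ[mg [M' gM]]; split.
  apply: cmeasM.
    exact: (cmeas_comp mf (@measurable_usubmx R d d)).
  exact: (cmeas_comp mg (@measurable_dsubmx R d d)).
exists (M * M') => z; rewrite (le_trans (norm1cM _ _))//.
rewrite -[z in rho z]vsubmxK rho_col mulrACA.
by apply: ler_pM; rewrite ?norm1c_ge0.
Qed.

Lemma rdom_covK f g : schwartz f -> schwartz g -> rdom (uncurry_cV (covK f g)).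
Proof. by move=> sf sg; apply: (csprod_rdom BB'); exact: csprod_covK. Qed.

Lemma rdom_fourier2_covK f g : schwartz f -> schwartz g ->
  rdom (fourier2 (uncurry_cV (covK f g))).
Proof.
by move=> sf sg; apply: (csprod_fourier_rdom BB'); exact: csprod_covK.
Qed.

Lemma fourier_translate n (k : 'cV[R]_n -> R[i]) x u : rdom k ->
  fourier (fun y => k (y - x)) u = fourier k u * expi (- (2 * pi * dot x u)).
Proof.
move=> dk; rewrite /fourier -cintZr; last exact/rdom_in_L1/rdom_fourier_arg.
pose G y := k (y - x) * expi (- (2 * pi * dot u y)).
have dG : rdom G by apply: rdom_fourier_arg; exact: rdom_shift.
rewrite -/G -(cint_affine (a := 1) x (or_introl erefl) dG.1); congr cint.
apply/funext => y; rewrite /G scale1r addrK -[RHS]mulrA; congr (_ * _).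
by rewrite -expiD; congr expi; rewrite dotDr [dot x u]dotC; ring.
Qed.

Lemma swap_mxE (z : 'cV[R]_E) : swap_mx R d *m z = col_mx (dsubmx z) (usubmx z).
Proof. by rewrite -[z in LHS]vsubmxK /swap_mx mul_block_col !bmxE. Qed.

Lemma rdom_swap (F : 'cV[R]_E -> R[i]) : rdom F -> rdom (fun z => F (swap_mx R d *m z)).
Proof.
move=> [mF [M FM]]; split; first exact: (cmeas_comp mF (measurable_mulmx _)).
have rhoE (z : 'cV[R]_E) : rho z = rho (usubmx z) * rho (dsubmx z).
  by rewrite -rho_col vsubmxK.
exists M => z; rewrite (le_trans (FM _))// swap_mxE rho_col rhoE.
by rewrite [rho (dsubmx z) * _]mulrC.
Qed.

Lemma measurable_chirp n (C : 'M[R]_n) : cmeas (chirp C).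
Proof.
apply: cmeas_expi; apply: measurable_funM => //; apply: measurable_dot.
  exact: measurable_mulmx.
exact: measurable_id.
Qed.

Lemma rdom_chirp n (C : 'M[R]_n) (F : 'cV[R]_n -> R[i]) :
  rdom F -> rdom (fun z => chirp C z * F z).
Proof.
move=> dF; have := rdomMb (b := 2) dF (measurable_chirp C) (fun x => norm1c_expi _).
by congr rdom; apply/funext => z; rewrite mulrC.
Qed.

Lemma chirp_covC (u eta : 'cV[R]_d) :
  chirp (- covC A13 A21) (col_mx u eta) = chirp (- A13) u * chirp A21 eta.
Proof.
rewrite /chirp /covC -expiD; congr expi.
rewrite !opp_block_mx mul_block_col !bmxE dot_col; ring.
Qed.

(** Used as the domain of [eq_phase_on], this set yields one phase for all [f] and [g]. *)
Definition schwartz_tensor (F : 'cV[R]_E -> R[i]) : Prop :=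
  exists f g, [/\ schwartz f, schwartz g & F = tensor f g].

Context (A13_sym : A13^T = A13) (A21_sym : A21^T = A21).

Definition covariant_op (F : 'cV[R]_E -> R[i]) : 'cV[R]_E -> R[i] :=
  fourier (fun z => chirp (- covC A13 A21) z *
    fourier2 (fun t => F (covM A11 *m t)) (swap_mx R d *m z)).

(** The factors are peeled off from the left. The two whose formulas need L^1 and L^2 act on
    functions with a majorant: [symp_FT2] on the kernel [covK], [symp_J] on its partial transform
    multiplied by the chirp. *)
Lemma metaplectic_covariant (mu : 'M[R]_(E + E) -> operator R E) :
  metaplectic mu ->
  eq_phase_on schwartz_tensor (mu (covariant_mx A11 A13 A21)) covariant_op.
Proof.
move=> mmu; rewrite covariant_factorization.
have uM := (mulmx1_invmx (covMV A11)).1.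
have uP := (mulmx1_invmx (swap_mxV R d)).1.
have CT : (- covC A13 A21)^T = - covC A13 A21.
  by rewrite trmxN /covC tr_block_mx !(trmx0, trmxN, A13_sym, A21_sym).
have sM := symplectic_D uM; have sP := symplectic_D uP.
have sF := symplectic_FT2 R d; have sV := symplectic_V CT; have sJ := symplectic_J R E.
have L12 F : rdom F -> in_L1 F /\ in_L2 F.
  by move=> dF; split; [exact: rdom_in_L1|exact: rdom_in_L2].
have tE f g : (fun t => tensor f g (covM A11 *m t)) = uncurry_cV (covK f g).
  by apply/funext => z; rewrite tensor_covM.
apply: (eq_phase_comp (dom' := fun F => in_L1 F /\ in_L2 F)
  (V := fun F z => chirp (- covC A13 A21) z *
    fourier2 (fun t => F (covM A11 *m t)) (swap_mx R d *m z))
  (U := @fourier R E) mmu sJ).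
- exact: symplecticM sV (symplecticM sP (symplecticM sF sM)).
- move=> _ [f [g [sf sg ->]]]; rewrite tE.
  have H : rdom (fun z => chirp (- covC A13 A21) z *
      fourier2 (uncurry_cV (covK f g)) (swap_mx R d *m z)).
    by apply/rdom_chirp/rdom_swap; exact: rdom_fourier2_covK.
  by split; [exact/rdom_in_L2/rdom_tensor|exact: H|exact: L12 H].
- apply: (eq_phase_comp (dom' := @in_L2 R E)
    (V := fun F z => fourier2 (fun t => F (covM A11 *m t)) (swap_mx R d *m z))
    (U := fun F z => chirp (- covC A13 A21) z * F z) mmu sV).
  + exact: symplecticM sP (symplecticM sF sM).
  + move=> _ [f [g [sf sg ->]]]; rewrite tE.
    have H : rdom (fun z => fourier2 (uncurry_cV (covK f g)) (swap_mx R d *m z)).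
      by apply/rdom_swap; exact: rdom_fourier2_covK.
    by split; [exact/rdom_in_L2/rdom_tensor|exact: H|exact: rdom_in_L2 H].
  + apply: (eq_phase_comp (dom' := @in_L2 R E)
      (V := fun F => fourier2 (fun t => F (covM A11 *m t)))
      (U := fun F z => F (swap_mx R d *m z)) mmu sP).
    * exact: symplecticM sF sM.
    * move=> _ [f [g [sf sg ->]]]; rewrite tE.
      have H := rdom_fourier2_covK sf sg.
      by split; [exact/rdom_in_L2/rdom_tensor|exact: H|exact: rdom_in_L2 H].
    * apply: (eq_phase_comp (dom' := fun F => in_L1 F /\ in_L2 F)
        (V := fun F t => F (covM A11 *m t)) (U := @fourier2 R d) mmu sF sM).
      - move=> _ [f [g [sf sg ->]]]; rewrite tE.
        have H := rdom_covK sf sg.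
        by split; [exact/rdom_in_L2/rdom_tensor|exact: H|exact: L12 H].
      - apply: eq_phase_sub (metaplectic_D1 mmu uM (normr_det_covM A11)); last by [].
        by move=> _ [f [g [sf sg ->]]]; exact/rdom_in_L2/rdom_tensor.
      - exact: metaplectic_FT2.
    * by apply: metaplectic_D1 => //; exact/normr_det_involution/swap_mxV.
  + exact: metaplectic_V.
- exact: metaplectic_J.
Qed.

Definition covariant_inner f g (x eta : 'cV[R]_d) : R[i] :=
  dist_conv (dist_fourier (dist_of (chirp (- A13))))
    (fun y => tensor f g (covL A11 *m col_mx y eta)) x.

(** The convolution unfolds to the chirp paired with the Fourier transform of y -> h(x - y). This
    function is the translate [covK f g eta (y - x)], and the translation produces the character in
    [x]. *)
Lemma covariant_innerE f g x eta : schwartz f -> schwartz g ->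
  covariant_inner f g x eta =
  cint (fun u => chirp (- A13) u * (fourier (covK f g eta) u * expi (- (2 * pi * dot x u)))).
Proof.
move=> sf sg; rewrite /covariant_inner /dist_conv /dist_fourier /dist_of.
congr cint; apply/funext => u; congr (_ * _).
rewrite -fourier_translate; last exact/rdom_slice/rdom_covK.
congr (fourier _ u); apply/funext => y; exact: tensor_covL.
Qed.

Lemma covariant_opE f g z : schwartz f -> schwartz g ->
  covariant_op (tensor f g) z =
  cint (fun eta => covariant_inner f g (usubmx z) eta * chirp A21 eta
    * expi (- (2 * pi * dot (dsubmx z) eta))).
Proof.
move=> sf sg; rewrite /covariant_op.
rewrite (_ : (fun t => tensor f g (covM A11 *m t)) = uncurry_cV (covK f g)); last first.
  by apply/funext => t; rewrite tensor_covM.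
have dFK := rdom_fourier2_covK sf sg.
(* [u] is integrated first: the character at (x, xi) splits, and its part in [eta] leaves the inner
   integral together with [chirp A21 eta]. *)
rewrite /fourier cint_col_sym; last first.
  exact/rdom_in_L1/rdom_fourier_arg/rdom_chirp/rdom_swap.
congr cint; apply/funext => eta.
have dk : rdom (fourier (covK f g eta)).
  by move: dFK; rewrite fourier2_uncurry => /(rdom_slice eta).
rewrite covariant_innerE// -mulrA -cintZr; last first.
  apply/rdom_in_L1/rdom_chirp; have := rdom_fourier_arg (usubmx z) dk.
  by [].
congr cint; apply/funext => u.
rewrite chirp_covC swap_mxE col_mxKu col_mxKd fourier2_uncurry /uncurry_cV col_mxKu col_mxKd.
rewrite -[z in dot z _]vsubmxK dot_col mulrDr opprD expiD; ring.
Qed.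

(** For A13 = 0 the chirp is 1, and the inner function is the double transform of [covK f g eta] at
    x, to be replaced by [covK f g eta (- x)]. The exceptional set in (eta, x) is null, so for
    almost every x it meets a null set of eta; this condition does not involve xi and lifts to
    almost every z. *)
Lemma covariant_inner_ae (mu : 'M[R]_(E + E) -> operator R E) f g :
  metaplectic mu -> A13 = 0 -> schwartz f -> schwartz g ->
  {ae leb E, forall z,
    cint (fun eta => covariant_inner f g (usubmx z) eta * chirp A21 eta
      * expi (- (2 * pi * dot (dsubmx z) eta))) =
    cint (fun eta => f (usubmx z + B *m eta) * (g (usubmx z - A11 *m eta))^*%C
      * chirp A21 eta * expi (- (2 * pi * dot (dsubmx z) eta)))}.
Proof.
move=> mmu A130 sf sg.
have dK := rdom_covK sf sg; have dFK := rdom_fourier2_covK sf sg.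
have innerE x eta : covariant_inner f g x eta = fourier (fourier (covK f g eta)) x.
  rewrite covariant_innerE//; congr cint; apply/funext => u.
  rewrite A130 oppr0 /chirp mul0mx /dot trmx0 mul0mx mxE mulr0 expi0 mul1r.
  by [].
have KE x eta : f (x + B *m eta) * (g (x - A11 *m eta))^*%C = covK f g eta (- x).
  by rewrite /covK opprK mulNmx ![_ + x]addrC.
have := ae_leb_col_sym (ae_fourier_inversion mmu dK dFK).
move=> /(ae_leb_usub d); apply: filterS => z Hz.
set x := usubmx z; set xi := dsubmx z.
have mrest : cmeas (fun eta : 'cV[R]_d => chirp A21 eta * expi (- (2 * pi * dot xi eta))).
  apply: cmeasM; first exact: measurable_chirp.
  apply: cmeas_expi; apply: (measurableT_comp (@oppr_measurable R setT)).
  exact: measurable_dotr.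
apply: ae_eq_cint.
- rewrite (_ : (fun _ => _) = fun eta => fourier2 (fourier2 (uncurry_cV (covK f g)))
      (col_mx eta x) * (chirp A21 eta * expi (- (2 * pi * dot xi eta)))); last first.
    apply/funext => eta; rewrite innerE !fourier2_uncurry /uncurry_cV col_mxKu col_mxKd.
    by rewrite mulrA.
  apply: cmeasM mrest.
  exact: (cmeas_comp (cmeas_fourier2 (cmeas_fourier2 dK.1)) (measurable_col_cVr x)).
- rewrite (_ : (fun _ => _) = fun eta => uncurry_cV (covK f g) (col_mx eta (- x)) *
      (chirp A21 eta * expi (- (2 * pi * dot xi eta)))); last first.
    apply/funext => eta; rewrite KE /uncurry_cV col_mxKu col_mxKd.
    by rewrite mulrA.
  apply: cmeasM mrest.
  exact: (cmeas_comp dK.1 (measurable_col_cVr (- x))).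
- apply: filterS Hz => eta; rewrite col_mxKu col_mxKd => H.
  by rewrite innerE KE H.
Qed.

End covariant_wigner.

Theorem theorem4p16 (R : realType) (d : nat)
    (A : 'M[R]_((d + d) + (d + d))) (A11 A13 A21 : 'M[R]_d)
    (A_symplectic : symplectic A)
    (A_covariant : A = covariant_mx A11 A13 A21)
    (A13_sym : A13 = A13^T) (A21_sym : A21 = A21^T) :
  let C : 'M[R]_(d + d) := block_mx A13 0 0 (- A21) in
  let L : 'M[R]_(d + d) :=
    block_mx 1%:M (1%:M - A11) 1%:M (- A11) in
  [/\ L \in unitmx,
      A = (symp_V C)^T *m symp_FT2 R d *m symp_D L &
      forall mu : 'M[R]_((d + d) + (d + d)) -> operator R (d + d),
      metaplectic mu ->
      exists2 c : R[i], `|c| = 1 &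
        forall f g : 'cV[R]_d -> R[i], schwartz f -> schwartz g ->
        {ae leb (d + d), forall z : 'cV[R]_(d + d),
          let x := usubmx z in let xi := dsubmx z in
          wigner mu A f g z =
          c * cint (fun eta : 'cV[R]_d =>
            dist_conv (dist_fourier (dist_of (chirp (- A13))))
              (fun y => tensor f g (L *m col_mx y eta)) x
            * chirp A21 eta * expi (- (2 * pi * dot xi eta)))} /\
        (A13 = 0 ->
        {ae leb (d + d), forall z : 'cV[R]_(d + d),
          let x := usubmx z in let xi := dsubmx z in
          wigner mu A f g z =
          c * cint (fun eta : 'cV[R]_d =>
            f (x + (1%:M - A11) *m eta) * (g (x - A11 *m eta))^*%C
            * chirp A21 eta * expi (- (2 * pi * dot xi eta)))})].
Proof.
move=> C L.
have A13T : A13^T = A13 by rewrite -A13_sym.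
have A21T : A21^T = A21 by rewrite -A21_sym.
split.
- exact: (mulmx1_invmx (covLV A11)).1.
- by rewrite A_covariant (covariant_decomposition A11 A13T A21T).
move=> mu mmu.
have [c cn H] := metaplectic_covariant A11 A13T A21T mmu.
exists c => // f g sf sg.
have {}H : {ae leb (d + d), forall z, wigner mu A f g z =
    c * cint (fun eta => covariant_inner A11 A13 f g (usubmx z) eta * chirp A21 eta
    * expi (- (2 * pi * dot (dsubmx z) eta)))}.
  have := H (tensor f g); rewrite A_covariant => {}H.
  apply: filterS (H _) => [z|]; first by rewrite /wigner => ->; rewrite covariant_opE.
  by exists f, g.
split; first exact: H.
(* Inversion holds with constant exactly 1, so the same [c] serves both formulas. *)
move=> A130; have := covariant_inner_ae A11 A21 mmu A130 sf sg.
by apply: filterS2 H => z -> ->.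
Qed.
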